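(* As $m,n\to\infty$, $$\operatorname{MISE}\left[\hat F^S_{m,n}\right]=n^{-1}C_1^S-m^{-1/2}n^{-1}C_2^S+m^{-2}C_3^S+o(m^{-1/2}n^{-1})+o(m^{-2})$$ with $$C_1^S=\int_0^\infty\sigma^2(x)e^{-ax}f(x)\,dx,\quad C_2^S=\int_0^\infty V^S(x)e^{-ax}f(x)\,dx,\quad C_3^S=\int_0^\infty (b^S(x))^2e^{-ax}f(x)\,dx,$$ where $\sigma^2(x)=F(x)(1-F(x))$, $V^S(x)=f(x)\left[\frac{x}{\pi}\right]^{1/2}$ and $b^S(x)=\frac{xf'(x)}{2}$.
   Context: Let $X_1,X_2,\dots$ be i.i.d. random variables with values in $[0,\infty)$, with distribution function $F$ ($F(0)=0$) and density $f$. Standing assumption: $F$ is continuous, and the first and second derivatives $f=F'$ and $f'=F''$ of $F$ exist and are continuous and bounded on $[0,\infty)$. The empirical distribution function is $F_n(x)=\frac1n\sum_{i=1}^n \mathbb{I}(X_i\le x)$. For $m\in\mathbb{N}$, $m\geq 1$, $k\in\{0,1,2,\dots\}$ and $x\ge 0$ let $V_{k,m}(x)=e^{-mx}\frac{(mx)^k}{k!}$ (with $0^0=1$). The Szasz estimator is $\hat F^S_{m,n}(x)=\sum_{k=0}^\infty F_n\left(\frac km\right)V_{k,m}(x)$. Fix a constant $a\in(0,\infty)$. The (weighted) mean-integrated squared error is $\operatorname{MISE}[\hat F^S_{m,n}]=\mathbb{E}\left[\int_0^\infty\left(\hat F^S_{m,n}(x)-F(x)\right)^2e^{-ax}f(x)\,dx\right]$.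 The notation $u=o(v)$ means $\lim|u/v|=0$ as $m,n\to\infty$. *)

(* Defs.v *)
From HB Require Import structures.
From mathcomp Require Import all_boot all_order all_algebra finmap.
From mathcomp Require Import all_classical all_reals all_analysis.

Set Implicit Arguments.
Unset Strict Implicit.
Unset Printing Implicit Defensive.

Import Order.TTheory GRing.Theory Num.Theory.
Import numFieldTopology.Exports numFieldNormedType.Exports.

Local Open Scope classical_set_scope.
Local Open Scope ring_scope.

Section Setting.
Context {d : measure_display} {T : measurableType d} {R : realType}
  (P : probability T R).
Implicit Types (X : nat -> {RV P >-> R}).

Definition mutually_independent X :=
  forall (J : {fset nat}) (B : nat -> set R),
    (forall i, measurable (B i)) ->
    P (\bigcap_(i in [set` J]) (X i @^-1` B i)) =
    (\prod_(i <- J) P (X i @^-1` B i))%E.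

Definition identically_distributed X :=
  forall (i j : nat) (B : set R), measurable B ->
    distribution P (X i) B = distribution P (X j) B.

Definition iid X := mutually_independent X /\ identically_distributed X.

(* The sample X_1, ..., X_n is X 0, ..., X n.-1. *)
Definition emp_cdf X (n : nat) (x : R) (w : T) : R :=
  n%:R^-1 * \sum_(i < n) (X i w <= x)%R%:R.

Definition szasz_weight (k m : nat) (x : R) : R :=
  expR (- (m%:R * x)) * ((m%:R * x) ^+ k / k`!%:R).

Definition szasz_estimator X (m n : nat) (x : R) (w : T) : R :=
  limn (series (fun k => emp_cdf X n (k%:R / m%:R) w * szasz_weight k m x)).

(* For m, n > 0 the estimator takes values in [0, 1], so the inner integral is
   finite as soon as f is a density. *)
Definition szasz_MISE X (F f : R -> R) (a : R) (m n : nat) : \bar R :=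
  'E_P[fun w => \int[lebesgue_measure]_(x in `[0, +oo[)
         ((szasz_estimator X m n x w - F x) ^+ 2 * expR (- (a * x)) * f x)].

End Setting.

Section Analysis.
Context {R : realType}.
Implicit Types (g F f : R -> R) (a : R).

Definition density_ge0 {d} {T : measurableType d} (P : probability T R)
    (Y : {RV P >-> R}) f :=
  forall B : set R, measurable B ->
    distribution P Y B =
    (\int[lebesgue_measure]_(x in B `&` `[0%R, +oo[) (f x)%:E)%E.

(* g' is the derivative of g on [0, +oo[, one-sided at the endpoint 0; the
   values of g and g' at negative reals are irrelevant. *)
Definition derivative_ge0 g (g' : R -> R) :=
  forall x, 0 <= x ->
    (g y - g x) / (y - x) @[y --> within `[0, +oo[ x^'] --> g' x.

Definition bounded_ge0 g := exists M, forall x, 0 <= x -> `|g x| <= M.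

Definition sigma2 F (x : R) : R := F x * (1 - F x).
Definition VS f (x : R) : R := f x * Num.sqrt (x / pi).
Definition bS (f' : R -> R) (x : R) : R := x * f' x / 2.

Definition C1S F f a : R :=
  \int[lebesgue_measure]_(x in `[0, +oo[) (sigma2 F x * expR (- (a * x)) * f x).
Definition C2S f a : R :=
  \int[lebesgue_measure]_(x in `[0, +oo[) (VS f x * expR (- (a * x)) * f x).
Definition C3S f (f' : R -> R) a : R :=
  \int[lebesgue_measure]_(x in `[0, +oo[)
    ((bS f' x) ^+ 2 * expR (- (a * x)) * f x).

(* u = o(v) as m and n tend jointly (and independently) to infinity. *)
Definition little_o_mn (u v : nat -> nat -> R) :=
  `|u p.1 p.2 / v p.1 p.2| @[p --> filter_prod \oo \oo] --> (0 : R).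

End Analysis.

(* Main.v *)
Require Import Defs.
From HB Require Import structures.
From mathcomp Require Import all_boot all_order all_algebra finmap.
From mathcomp Require Import all_classical all_reals all_analysis.
From mathcomp Require Import measurable_realfun ring lra zify.

(** The mean squared error at [x] splits as [V_m(x) / n + B_m(x)^2], where [B_m] is
    the bias of the Szasz operator and, for independent Poisson variables [K] and [L]
    of mean [m x], [V_m(x) = E F(min(K, L) / m) - (E F(K / m))^2]. A Taylor expansion
    gives [m B_m(x) -> x f'(x) / 2]. In [V_m], the correction to [F (1 - F)] is
    [- f(x) E (K - L)^+ / m] up to [O(x / m)]; Stein's identity for the Poisson law
    turns [E (K - L)^+] into [m x (P(K = L) + P(K = L + 1))], and conditioning on
    [K + L] turns this into a Poisson mean of central binomial probabilities, which
    the Wallis integrals estimate as [sqrt(m x / pi)]. All these limits hold with a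
    bound [O((1 + x)^2)] uniform in [m], so dominated convergence against
    [e^(- a x) f(x)] integrates them. Both remainders thus reduce to sequences in
    [m] alone. *)

Set Implicit Arguments.
Unset Strict Implicit.
Unset Printing Implicit Defensive.

Import Order.TTheory GRing.Theory Num.Theory.
Import numFieldTopology.Exports numFieldNormedType.Exports.

Local Open Scope classical_set_scope.
Local Open Scope ring_scope.

(** * Poisson means *)

Section PoissonMean.
Context {R : realType}.
Implicit Types (l : R) (g h : nat -> R).

(** No Poisson variable is constructed: a Poisson mean is the limit of a weighted series, two
    independent variables give an iterated limit, and Stein's identity is an index shift from which
    all moments follow. The delicate quantity is the mean of (K - L)^+: it is needed to leading
    order with its exact constant, since it produces sqrt(x / pi), and a crude moment bound gives
    only the rate. A central limit theorem is avoided: the Wallis integrals give two-sided bounds on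
    central binomial probabilities, and tangent lines carry them over to Poisson means, as 1/sqrt is
    convex and sqrt concave. The bias meets another obstacle: F has only two derivatives, so its
    Taylor remainder is small relative to (y - x)^2 near x but without a rate, while the Poisson
    grid is unbounded. Away from x a fourth power takes over, whose mean is still negligible after
    multiplication by m. *)

Definition poisson_weight l (k : nat) : R := expR (- l) * (l ^+ k / k`!%:R).

(** At [l = m x] the weight is [szasz_weight k m x], so the estimator is, by conversion, the Poisson
    mean of the empirical distribution function on the grid. As [limn] is defined for every
    sequence, summability is carried separately. *)
Definition pmean l h : R := limn (series (fun k => h k * poisson_weight l k)).

Definition psummable l h := cvgn (series (fun k => `|h k * poisson_weight l k|)).

Lemma poisson_weight_ge0 l k : 0 <= l -> 0 <= poisson_weight l k.
Proof. by move=> l0; rewrite mulr_ge0 ?expR_ge0 ?divr_ge0 ?exprn_ge0. Qed.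

Lemma poisson_weightS l k :
  k.+1%:R * poisson_weight l k.+1 = l * poisson_weight l k.
Proof.
rewrite /poisson_weight factS natrM exprS.
have k1 : k.+1%:R != 0 :> R by rewrite pnatr_eq0.
have kf : k`!%:R != 0 :> R by rewrite pnatr_eq0 -lt0n fact_gt0.
by field; rewrite kf addrC natr1.
Qed.

Lemma psummable_cvg l h :
  psummable l h -> cvgn (series (fun k => h k * poisson_weight l k)).
Proof. exact: (@normed_cvg _ R^o). Qed.

Lemma psummable_le l g h : (forall k, `|g k| <= `|h k|) ->
  psummable l h -> psummable l g.
Proof.
move=> gh; apply: series_le_cvg => k //=.
by rewrite !normrM ler_wpM2r.
Qed.

Lemma psummable_cst l (c : R) : psummable l (cst c).
Proof.
rewrite /psummable; have -> : series (fun k => `|cst c k * poisson_weight l k|) =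
   series ((`|c| * expR (- l)) *: exp_coeff `|l|).
  apply/funext => n; apply: eq_bigr => k _ /=.
  rewrite !normrM (ger0_norm (expR_ge0 _)) normfV normrX normr_nat.
  by rewrite /exp_coeff/= mulrA.
exact/is_cvg_seriesZ/is_cvg_series_exp_coeff.
Qed.

Lemma psummable_bounded l (c : R) h : (forall k, `|h k| <= c) -> psummable l h.
Proof.
move=> hc; apply: (@psummable_le _ _ (cst c)); last exact: psummable_cst.
by move=> k /=; rewrite (le_trans (hc k))// ler_norm.
Qed.

Lemma psummableD l g h : psummable l g -> psummable l h ->
  psummable l (fun k => g k + h k).
Proof.
move=> sg sh; have := is_cvg_seriesD sg sh.
apply: series_le_cvg => k //=; first by rewrite /GRing.add/= addr_ge0.
by rewrite mulrDl ler_normD.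
Qed.

Lemma psummableZ l (c : R) h : psummable l h -> psummable l (fun k => c * h k).
Proof.
move=> sh; have := @is_cvg_seriesZ _ _ `|c| sh.
apply: series_le_cvg => k //=.
  by rewrite mulr_ge0.
by rewrite -mulrA normrM.
Qed.

Lemma psummableN l h : psummable l h -> psummable l (fun k => - h k).
Proof. by apply: psummable_le => k; rewrite normrN. Qed.

Lemma psummableB l g h : psummable l g -> psummable l h ->
  psummable l (fun k => g k - h k).
Proof. by move=> sg sh; apply: psummableD => //; exact: psummableN. Qed.

Lemma series_poisson_shift l h n :
  series (fun k => k%:R * h k * poisson_weight l k) n.+1 =
  l * series (fun k => h k.+1 * poisson_weight l k) n.
Proof.
rewrite /series /= big_nat_recl//= !mul0r add0r.
rewrite mulr_sumr; apply: eq_bigr => k _.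
by rewrite -mulrA mulrCA poisson_weightS mulrCA.
Qed.

Lemma psummable_stein l h : psummable l (fun k => h k.+1) ->
  psummable l (fun k => k%:R * h k).
Proof.
move=> sh.
apply/cvg_ex; exists (`|l| * limn (series (fun k => `|h k.+1 * poisson_weight l k|))).
rewrite -cvg_shiftS.
have -> : (fun n => (series (fun k => `|k%:R * h k * poisson_weight l k|)) n.+1)
    = (fun n => `|l| * (series (fun k => `|h k.+1 * poisson_weight l k|)) n).
  apply/funext => n; rewrite /series/= big_nat_recl//= !mul0r normr0 add0r.
  rewrite mulr_sumr; apply: eq_bigr => k _.
  by rewrite -mulrA mulrCA poisson_weightS mulrCA normrM.
by apply: cvgM => //; exact: cvg_cst.
Qed.

(** The factor [k] kills the term of index 0, and the recurrence of the weights shifts the others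
    down by one. *)
Lemma pmean_stein l h : psummable l (fun k => h k.+1) ->
  pmean l (fun k => k%:R * h k) = l * pmean l (fun k => h k.+1).
Proof.
move=> sh; apply/cvg_lim => //; rewrite -cvg_shiftS.
under eq_fun do rewrite series_poisson_shift.
by apply: cvgM; [exact: cvg_cst|exact: psummable_cvg].
Qed.

Lemma pmean_cvg l h : psummable l h ->
  series (fun k => h k * poisson_weight l k) @ \oo --> pmean l h.
Proof. exact: psummable_cvg. Qed.

Lemma eq_pmean l g h : g =1 h -> pmean l g = pmean l h.
Proof. by move=> /funext ->. Qed.

Lemma pmeanD l g h : psummable l g -> psummable l h ->
  pmean l (fun k => g k + h k) = pmean l g + pmean l h.
Proof.
move=> /psummable_cvg sg /psummable_cvg sh; rewrite -lim_seriesD//.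
by congr (limn (series _)); apply/funext => k; rewrite mulrDl.
Qed.

Lemma pmeanZ l c h : psummable l h -> pmean l (fun k => c * h k) = c * pmean l h.
Proof.
move=> /psummable_cvg sh; rewrite -[RHS](lim_seriesZ _ sh).
by congr (limn (series _)); apply/funext => k; rewrite -mulrA.
Qed.

Lemma pmeanN l h : psummable l h -> pmean l (fun k => - h k) = - pmean l h.
Proof.
by move=> sh; rewrite -mulN1r -pmeanZ//; apply: eq_pmean => k; rewrite mulN1r.
Qed.

Lemma pmeanB l g h : psummable l g -> psummable l h ->
  pmean l (fun k => g k - h k) = pmean l g - pmean l h.
Proof. by move=> sg sh; rewrite pmeanD ?pmeanN//; exact: psummableN. Qed.

Lemma pmean_cst l c : pmean l (fun=> c) = c.
Proof.
transitivity (limn (series ((c * expR (- l)) *: exp_coeff l))).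
  by congr (limn (series _)); apply/funext => k; rewrite /poisson_weight mulrA.
rewrite lim_seriesZ; last exact: is_cvg_series_exp_coeff.
transitivity (c * expR (- l) * expR l) => //.
by rewrite -mulrA [X in _ * X]mulrC expRxMexpNx_1 mulr1.
Qed.

Lemma le_pmean l g h : 0 <= l -> psummable l g -> psummable l h ->
  (forall k, g k <= h k) -> pmean l g <= pmean l h.
Proof.
move=> l0 /psummable_cvg sg /psummable_cvg sh gh; apply: lim_series_le => // k.
by rewrite ler_wpM2r// poisson_weight_ge0.
Qed.

Lemma pmean_ge0 l h : 0 <= l -> psummable l h -> (forall k, 0 <= h k) ->
  0 <= pmean l h.
Proof.
by move=> l0 sh h0; rewrite -[leLHS](pmean_cst l 0) le_pmean//; exact: psummable_cst.
Qed.

Lemma ler_norm_pmean l g h : 0 <= l -> psummable l h ->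
  (forall k, `|g k| <= h k) -> `|pmean l g| <= pmean l h.
Proof.
move=> l0 sh gh; have sg : psummable l g.
  by apply: psummable_le sh => k; rewrite (le_trans (gh k))// ler_norm.
rewrite ler_norml -pmeanN// !le_pmean//; try exact: psummableN.
  by move=> k; have := gh k; rewrite ler_norml => /andP[].
by move=> k; have := gh k; rewrite ler_norml => /andP[].
Qed.

(** The shift [c] varies in the induction because Stein's identity turns [k + c] into
    [k + (1 + c)]. *)
Lemma psummable_expn l (c : R) n : psummable l (fun k => (k%:R + c) ^+ n).
Proof.
elim: n c => [|n IHn] c; first exact: psummable_cst.
have -> : (fun k => (k%:R + c) ^+ n.+1) =
          (fun k : nat => k%:R * (k%:R + c) ^+ n + c * (k%:R + c) ^+ n).
  by apply/funext => k; rewrite exprS mulrDl.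
apply: psummableD; last exact: psummableZ.
apply: (@psummable_stein _ (fun k => (k%:R + c) ^+ n)).
have -> // : (fun k => (k.+1%:R + c) ^+ n) = (fun k : nat => (k%:R + (1 + c)) ^+ n).
by apply/funext => k; rewrite -natr1 addrA.
Qed.

Lemma psummable_nat l : psummable l (fun k => k%:R).
Proof.
have := @psummable_expn l 0 1.
by apply: psummable_le => k; rewrite addr0.
Qed.

Lemma pmean_nat l : pmean l (fun k => k%:R) = l.
Proof.
transitivity (pmean l (fun k => k%:R * 1)).
  by apply: eq_pmean => k; rewrite mulr1.
by rewrite (@pmean_stein l (fun=> 1)) ?pmean_cst ?mulr1//; exact: psummable_cst.
Qed.

(** One factor [k + c] is split: [k] goes through Stein's identity, [c] comes out. Iterated from
    [c = - l], this yields the centered moments. *)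
Lemma pmean_recr l (c : R) n :
  pmean l (fun k => (k%:R + c) ^+ n.+1) =
  l * pmean l (fun k => (k%:R + (1 + c)) ^+ n)
  + c * pmean l (fun k => (k%:R + c) ^+ n).
Proof.
have sS : psummable l (fun k => (k.+1%:R + c) ^+ n).
  have -> : (fun k => (k.+1%:R + c) ^+ n) = (fun k : nat => (k%:R + (1 + c)) ^+ n).
    by apply/funext => k; rewrite -natr1 addrA.
  exact: psummable_expn.
rewrite -(@pmeanZ _ c); last exact: psummable_expn.
have -> : pmean l (fun k => (k%:R + (1 + c)) ^+ n) =
          pmean l (fun k => (k.+1%:R + c) ^+ n).
  by apply: eq_pmean => k; rewrite -natr1 addrA.
rewrite -(@pmean_stein _ (fun k => (k%:R + c) ^+ n))// -pmeanD.
- by apply: eq_pmean => k; rewrite exprS mulrDl.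
- exact: (@psummable_stein _ (fun k => (k%:R + c) ^+ n)).
- exact/psummableZ/psummable_expn.
Qed.

Lemma pmean_centered2 l : pmean l (fun k => (k%:R - l) ^+ 2) = l.
Proof.
rewrite !pmean_recr !(eq_pmean _ (fun k => expr0 _)) !pmean_cst; ring.
Qed.

Lemma pmean_centered4 l :
  pmean l (fun k => (k%:R - l) ^+ 4) = l + 3 * l ^+ 2.
Proof.
rewrite !pmean_recr !(eq_pmean _ (fun k => expr0 _)) !pmean_cst; ring.
Qed.

End PoissonMean.

(** * Wallis integrals and central binomial probabilities *)

Section Wallis.
Context {R : realType}.
Local Notation mu := (@lebesgue_measure R).

Definition wallis_integral (n : nat) : R :=
  \int[mu]_(x in `[0, pi / 2]) (cos x ^+ n).

Let pihalf_gt0 : 0 < pi / 2 :> R.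
Proof. by rewrite divr_gt0// pi_gt0. Qed.

Let continuous_cosX n : continuous (fun x : R => cos x ^+ n).
Proof.
move=> x; apply: (@continuous_comp _ _ _ cos (fun y => y ^+ n)).
  exact: continuous_cos.
exact: exprn_continuous.
Qed.

Let integrable_cosX n : mu.-integrable `[0, pi / 2] (EFin \o (fun x : R => cos x ^+ n)).
Proof. 
apply: continuous_compact_integrable; first exact: segment_compact.
exact/continuous_subspaceT/continuous_cosX.
Qed.

Lemma wallis_integral0 : wallis_integral 0 = pi / 2.
Proof.
rewrite /wallis_integral; under eq_Rintegral do rewrite expr0.
by rewrite Rintegral_cst//= mul1r lebesgue_measure_itv/= lte_fin pihalf_gt0/= subr0.
Qed.

(** This primitive vanishes at both 0 and pi / 2, so integrating its derivative is already the
    Wallis recurrence. *)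
Lemma is_derive_cosXsin n (x : R) :
  is_derive x 1 (fun x => cos x ^+ n.+1 * sin x)
    (n.+2%:R * cos x ^+ n.+2 - n.+1%:R * cos x ^+ n).
Proof.
have d : is_derive x 1 (fun y : R => cos y ^+ n.+1) (n.+1%:R * cos x ^+ n * - sin x).
  rewrite -exprfctE; apply: is_derive_eq.
  by rewrite /GRing.scale/=.
apply: is_derive_eq; rewrite /GRing.scale/=.
have := cos2Dsin2 x; set c := cos x; set s := sin x => cs.
have -> : s * (n.+1%:R * c ^+ n * - s) = - n.+1%:R * c ^+ n * (s ^+ 2) by ring.
have -> : s ^+ 2 = 1 - c ^+ 2 by rewrite -cs; ring.
rewrite -[n.+2%:R]natr1 !exprS; ring.
Qed.

Lemma wallis_integralSS n :
  n.+2%:R * wallis_integral n.+2 = n.+1%:R * wallis_integral n.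
Proof.
apply/eqP; rewrite -subr_eq0; apply/eqP.
rewrite -!RintegralZl// -RintegralB//; last 2 first.
- exact: (integrableZl _ _ (integrable_cosX n.+2)).
- exact: (integrableZl _ _ (integrable_cosX n)).
rewrite /Rintegral (@continuous_FTC2 _ _ (fun x => cos x ^+ n.+1 * sin x))//.
- by rewrite cos_pihalf sin0 !mulr0 expr0n/= mul0r subrr.
- apply: continuous_subspaceT => x.
  by apply: cvgB; apply: cvgM; [exact: cvg_cst|exact: continuous_cosX
                             |exact: cvg_cst|exact: continuous_cosX].
- have c : continuous (fun x : R => cos x ^+ n.+1 * sin x).
    by move=> x; apply: cvgM; [exact: continuous_cosX|exact: continuous_sin].
  split.
  + by move=> x _; apply: ex_derive; exact: is_derive_cosXsin.
  + exact/cvg_at_right_filter/c.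
  + exact/cvg_at_left_filter/c.
- by move=> x _; rewrite derive1E; apply: derive_val; exact: is_derive_cosXsin.
Qed.

Lemma wallis_integral_ge0 n : 0 <= wallis_integral n.
Proof.
apply: Rintegral_ge0 => x; rewrite /= in_itv/= => /andP[x0 xp].
by rewrite exprn_ge0// cos_ge0_pihalf// xp (le_trans _ x0)// oppr_le0 ltW.
Qed.

Lemma wallis_integralS_le n : wallis_integral n.+1 <= wallis_integral n.
Proof.
apply: le_Rintegral => // x; rewrite /= in_itv/= => /andP[x0 xp].
rewrite exprS ler_piMl ?cos_le1// exprn_ge0// cos_ge0_pihalf//.
by rewrite xp (le_trans _ x0)// oppr_le0 ltW.
Qed.

Lemma wallis_integral1 : wallis_integral 1 = 1.
Proof.
rewrite /wallis_integral /Rintegral (@continuous_FTC2 _ _ sin)//=.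
- by rewrite sin_pihalf sin0 subr0.
- by apply: continuous_subspaceT => x; exact: (@continuous_cosX 1 x).
- split.
  + by move=> x _; exact: derivable_sin.
  + exact/cvg_at_right_filter/continuous_sin.
  + exact/cvg_at_left_filter/continuous_sin.
- by move=> x _; rewrite derive1E expr1 derive_val.
Qed.

(** The two-step recurrence makes this product independent of [n]; its value is read off at
    [n = 0]. *)
Lemma wallis_integral_mul n :
  n.+1%:R * (wallis_integral n * wallis_integral n.+1) = pi / 2.
Proof.
elim: n => [|n IHn]; first by rewrite wallis_integral0 wallis_integral1 mul1r mulr1.
by rewrite mulrCA wallis_integralSS mulrCA [X in _ * X]mulrC.
Qed.

(* The probability that a simple random walk of length [n] ends at [0] ([n] even)
   or at [1] ([n] odd). *)
Definition central_bin (n : nat) : R := 'C(n, n./2)%:R / 2 ^+ n.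

Lemma bin_doubleS k : (k.+1 * 'C(k.+1.*2, k.+1) = 2 * k.*2.+1 * 'C(k.*2, k))%N.
Proof.
have e1 := mul_bin_left k.*2.+1 k.
have e2 : (k.+1 * 'C(k.*2.+2, k.+1) = k.*2.+2 * 'C(k.*2.+1, k))%N.
  by rewrite mul_bin_diag.
have e3 : (k.+1 * 'C(k.*2.+1, k) = k.*2.+1 * 'C(k.*2, k))%N.
  by have := mul_bin_down k.*2.+1 k; rewrite -addnn subSn ?leq_addl// addnK addnn/= => ->.
rewrite doubleS e2 -[k.*2.+2]doubleS -mul2n -!mulnA; congr (_ * _)%N.
exact: e3.
Qed.

(** Both sides equal 1 at [k = 0] and satisfy the same recurrence from [k] to [k + 1]. *)
Lemma central_bin_double k : central_bin k.*2 = 2 / pi * wallis_integral k.*2.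
Proof.
have pi0 : pi != 0 :> R by rewrite gt_eqF ?pi_gt0.
elim: k => [|k IHk].
  rewrite double0 /central_bin wallis_integral0 bin0 expr0.
  by move: (@pi R) pi0 => p p0; field.
have k0 : k.*2.+2%:R != 0 :> R by rewrite pnatr_eq0.
have k1 : k.+1%:R != 0 :> R by rewrite pnatr_eq0.
apply: (mulfI k0); rewrite [RHS]mulrCA [k.+1.*2]doubleS wallis_integralSS [RHS]mulrCA -IHk.
rewrite /central_bin /= !doubleK.
have /(congr1 (fun i : nat => i%:R : R)) := bin_doubleS k.
rewrite doubleS !natrM => e.
have -> : k.*2.+2%:R = 2 * k.+1%:R :> R by rewrite -doubleS -mul2n natrM.
have -> : 'C(k.*2.+2, k.+1)%:R = (2 * k.*2.+1%:R * 'C(k.*2, k)%:R) / k.+1%:R :> R.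
  by rewrite -e mulrC mulKf.
rewrite !exprS.
have e2 : 2 ^+ k.*2 != 0 :> R by rewrite expf_neq0.
move: (k.+1%:R : R) (2 ^+ k.*2 : R) k1 e2 => u v u0 v0.
by field; rewrite u0 v0.
Qed.

(** By Pascal's rule and symmetry, the central coefficient of an even row is twice the middle one of
    the row before. Odd indices thus reduce to even ones. *)
Lemma central_binS_double k : central_bin k.*2.+1 = central_bin k.*2.+2.
Proof.
rewrite /central_bin /= uphalf_double doubleK exprS.
have /(congr1 (fun i : nat => i%:R : R)) : ('C(k.*2.+2, k.+1) = 2 * 'C(k.*2.+1, k))%N.
  rewrite binS -(@bin_sub k.*2.+1 k.+1) ?ltnS -?addnn ?leq_addr//.
  by rewrite subSS addnK mul2n addnn.
rewrite natrM => ->; rewrite [X in _ = _ / X]exprS.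
have e2 : 2 ^+ k.*2.+1 != 0 :> R by rewrite expf_neq0.
have e3 : 2 ^+ k.*2 != 0 :> R by rewrite expf_neq0.
by rewrite exprS; field.
Qed.

(** Replacing one factor of the squared Wallis integral by the next integral lowers it, by
    monotonicity, and the resulting product is known exactly. The preceding integral gives the upper
    bound below in the same way. *)
Lemma central_bin_double_sqr_ge k :
  2 / (pi * k.*2.+1%:R) <= central_bin k.*2 ^+ 2.
Proof.
have pi0 : 0 < pi :> R by rewrite pi_gt0.
have := wallis_integral_mul k.*2.
have := wallis_integralS_le k.*2.
rewrite central_bin_double; have := wallis_integral_ge0 k.*2.
move: (wallis_integral k.*2) (wallis_integral k.*2.+1) (@pi R) pi0 => w w1 p p0 w0 w1w e.
have k0 : 0 < k.*2.+1%:R :> R by rewrite ltr0n.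
rewrite -(ler_pM2l (_ : 0 < p ^+ 2 * k.*2.+1%:R)) ?mulr_gt0 ?exprn_gt0//.
have -> : p ^+ 2 * k.*2.+1%:R * (2 / (p * k.*2.+1%:R)) = 4 * (p / 2).
  by field; rewrite !gt_eqF.
have -> : p ^+ 2 * k.*2.+1%:R * (2 / p * w) ^+ 2 = 4 * (k.*2.+1%:R * (w * w)).
  by field; rewrite !gt_eqF.
by rewrite -e ler_pM2l// ler_pM2l// ler_wpM2l.
Qed.

Lemma central_bin_double_sqr_le k :
  central_bin k.+1.*2 ^+ 2 <= 2 / (pi * k.+1.*2%:R).
Proof.
have pi0 : 0 < pi :> R by rewrite pi_gt0.
have := wallis_integral_mul k.*2.+1.
have := wallis_integralS_le k.*2.+1.
rewrite central_bin_double doubleS; have := wallis_integral_ge0 k.*2.+2.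
move: (wallis_integral k.*2.+2) (wallis_integral k.*2.+1) (@pi R) pi0 => w w1 p p0 w0 w1w e.
have k0 : 0 < k.*2.+2%:R :> R by rewrite ltr0n.
rewrite -(ler_pM2l (_ : 0 < p ^+ 2 * k.*2.+2%:R)) ?mulr_gt0 ?exprn_gt0//.
have -> : p ^+ 2 * k.*2.+2%:R * (2 / (p * k.*2.+2%:R)) = 4 * (p / 2).
  by field; rewrite !gt_eqF.
have -> : p ^+ 2 * k.*2.+2%:R * (2 / p * w) ^+ 2 = 4 * (k.*2.+2%:R * (w * w)).
  by field; rewrite !gt_eqF.
by rewrite -e ler_pM2l// ler_pM2l// ler_wpM2r.
Qed.

Lemma central_bin_ge0 n : 0 <= central_bin n.
Proof. by rewrite divr_ge0// exprn_ge0. Qed.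

(** The [n + 2] comes from odd [n], where the value is that of the even index [n + 1]. *)
Lemma central_bin_sqr_ge n : 2 / (pi * n.+2%:R) <= central_bin n ^+ 2.
Proof.
have pi0 : 0 < pi :> R by rewrite pi_gt0.
have le_inv (i j : nat) : (0 < i <= j)%N -> 2 / (pi * j%:R) <= 2 / (pi * i%:R) :> R.
  move=> /andP[i0 ij]; rewrite ler_pM2l// lef_pV2 ?posrE ?mulr_gt0 ?ltr0n ?(leq_trans i0)//.
  by rewrite ler_pM2l// ler_nat.
rewrite -(odd_double_half n); case: (odd n) => /=.
  by rewrite central_binS_double -doubleS (le_trans _ (central_bin_double_sqr_ge _)).
by rewrite add0n (le_trans _ (central_bin_double_sqr_ge _))//; apply: le_inv; rewrite /= leqnSn.
Qed.

Lemma central_bin_sqr_le n : central_bin n.+1 ^+ 2 <= 2 / (pi * n.+1%:R).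
Proof.
have pi0 : 0 < pi :> R by rewrite pi_gt0.
have le_inv (i j : nat) : (0 < i <= j)%N -> 2 / (pi * j%:R) <= 2 / (pi * i%:R) :> R.
  move=> /andP[i0 ij]; rewrite ler_pM2l// lef_pV2 ?posrE ?mulr_gt0 ?ltr0n ?(leq_trans i0)//.
  by rewrite ler_pM2l// ler_nat.
rewrite -(odd_double_half n); case: (odd n) => /=.
  by rewrite add1n -doubleS central_bin_double_sqr_le.
rewrite add0n central_binS_double -doubleS (le_trans (central_bin_double_sqr_le _))//.
by apply: le_inv; rewrite doubleS/= leqnSn.
Qed.

Lemma central_bin_le1 n : central_bin n <= 1.
Proof.
rewrite ler_pdivrMr ?exprn_gt0// mul1r -natrX ler_nat.
have := Pascal 1 1 n; rewrite addn1 => ->.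
have nn : (n./2 < n.+1)%N by rewrite ltnS -{2}(odd_double_half n) -addnn addnA leq_addl.
rewrite (bigD1 (Ordinal nn))//= !exp1n !muln1.
exact: leq_addr.
Qed.

End Wallis.

(** * The mean of the positive part of a difference of Poisson variables *)

Section PoissonExcess.
Context {R : realType}.
Implicit Types (l : R) (h : nat -> R).

Lemma pmean_finite l h n : (forall k, (n <= k)%N -> h k = 0) ->
  pmean l h = \sum_(k < n) h k * poisson_weight l k.
Proof.
move=> h0; apply/cvg_lim => //; apply: cvg_near_cst.
exists n => // N /= nN; rewrite /series /= (big_cat_nat _ nN)//= big_mkord.
rewrite [X in _ + X = _]big_nat_cond [X in _ + X = _]big1 ?addr0// => k /andP[/andP[nk _] _].
by rewrite h0// mul0r.
Qed.

(* The mean of [(K - L)^+] for independent Poisson variables [K] and [L]: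
   half of the mean absolute difference. *)
Definition poisson_excess l : R :=
  pmean l (fun k => pmean l (fun j => (k - j)%N%:R)).

Let ltmass l (k : nat) : R := \sum_(j < k) poisson_weight l j.

Let prev_weight l (k : nat) : R := if k is j.+1 then poisson_weight l j else 0.

(** Here [ltmass l k] is P(L < k), and the recurrence of the weights applied to the sum of [j] over
    [j < k] lowers its range by one. At [k = 0] the truncated predecessor is harmless: both masses
    are empty sums. *)
Lemma inner_excessE l k :
  pmean l (fun j => (k - j)%N%:R) = k%:R * ltmass l k - l * ltmass l k.-1.
Proof.
rewrite (@pmean_finite _ _ k); last by move=> j; rewrite -subn_eq0 => /eqP ->.
have -> : l * ltmass l k.-1 = \sum_(j < k) j%:R * poisson_weight l j.
  case: k => [|k]; first by rewrite /ltmass !big_ord0 mulr0.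
  rewrite big_ord_recl mul0r add0r /ltmass mulr_sumr; apply: eq_bigr => j _.
  by rewrite -poisson_weightS.
rewrite /ltmass mulr_sumr -sumrB; apply: eq_bigr => j _.
by rewrite natrB ?mulrBl// ltnW.
Qed.

Lemma ltmass_bound l k : 0 <= l -> `|ltmass l k| <= 1.
Proof.
move=> l0; rewrite ger0_norm; last first.
  by rewrite /ltmass sumr_ge0// => j _; exact: poisson_weight_ge0.
have nd : nondecreasing_seq (series (fun k => 1 * poisson_weight l k)).
  by apply: nondecreasing_series => j _ _; rewrite mul1r poisson_weight_ge0.
have := nondecreasing_cvgn_le nd (psummable_cvg (@psummable_cst _ l 1)) k.
rewrite -[limn _]/(pmean l (fun=> 1)) pmean_cst; apply: le_trans.
rewrite /series/= big_mkord /ltmass le_eqVlt; apply/orP; left; apply/eqP.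
by apply: eq_bigr => j _; rewrite mul1r.
Qed.

(** Stein's identity in the outer variable turns k P(L < k) into l P(L < k + 1); the difference with
    l P(L < k - 1) leaves only P(L = k) and P(L = k - 1). *)
Lemma poisson_excessE l : 0 <= l -> poisson_excess l =
  l * pmean l (fun k => poisson_weight l k + prev_weight l k).
Proof.
move=> l0.
have sQ (i : nat -> nat) : psummable l (fun k => ltmass l (i k)).
  by apply: (@psummable_bounded _ _ 1) => k; exact: ltmass_bound.
rewrite /poisson_excess (eq_pmean _ (inner_excessE l)) pmeanB; last 2 first.
- by apply: (@psummable_stein _ _ (ltmass l)); exact: (sQ S).
- by apply: psummableZ; exact: (sQ predn).
rewrite (@pmean_stein _ _ (ltmass l)); last exact: (sQ S).
rewrite pmeanZ; last exact: (sQ predn).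
rewrite -mulrBr -pmeanB; [|exact: (sQ S)|exact: (sQ predn)].
congr (_ * _); apply: eq_pmean => -[|k] /=.
  by rewrite /ltmass big_ord_recr/= addr0 addrAC subrr add0r.
by rewrite /ltmass !big_ord_recr/=; ring.
Qed.

Let expRN2 l : expR (- (2 * l)) = expR (- l) * expR (- l).
Proof. by rewrite -expRD; congr expR; ring. Qed.

(** The sum K + L is Poisson of mean [2 * l], and given K + L = 2k the variable K is binomial: both
    sides are P(K = k, L = k). The odd case below is P(K = k, L = k + 1). *)
Lemma poisson_weight_double_even l k :
  central_bin k.*2 * poisson_weight (2 * l) k.*2 = poisson_weight l k ^+ 2.
Proof.
rewrite /central_bin /poisson_weight doubleK expRN2 -addnn.
have := bin_fact (leq_addr k k); rewrite addnK.
move=> /(congr1 (fun i : nat => i%:R : R)); rewrite !natrM => <-.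
rewrite exprMn [l ^+ (k + k)]exprD.
have e2 : 2 ^+ (k + k) != 0 :> R by rewrite expf_neq0.
have e3 : 'C(k + k, k)%:R != 0 :> R by rewrite pnatr_eq0 -lt0n bin_gt0 leq_addl.
have e4 : k`!%:R != 0 :> R by rewrite pnatr_eq0 -lt0n fact_gt0.
move: (2 ^+ (k + k) : R) ('C(k + k, k)%:R : R) (k`!%:R : R) (l ^+ k) (expR _) e2 e3 e4.
by move=> u v w z y u0 v0 w0; field; rewrite u0 v0 w0.
Qed.

Lemma poisson_weight_double_odd l k :
  central_bin k.*2.+1 * poisson_weight (2 * l) k.*2.+1 =
  poisson_weight l k * poisson_weight l k.+1.
Proof.
rewrite /central_bin /poisson_weight /= uphalf_double expRN2 -addnn -addnS.
have := bin_fact (leq_addr k.+1 k); rewrite addKn.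
move=> /(congr1 (fun i : nat => i%:R : R)); rewrite !natrM => <-.
rewrite exprMn [l ^+ (k + _)]exprD.
have e2 : 2 ^+ (k + k.+1) != 0 :> R by rewrite expf_neq0.
have e3 : 'C(k + k.+1, k)%:R != 0 :> R by rewrite pnatr_eq0 -lt0n bin_gt0 leq_addr.
have e4 : k`!%:R != 0 :> R by rewrite pnatr_eq0 -lt0n fact_gt0.
have e5 : 1 + k%:R != 0 :> R by rewrite addrC natr1 pnatr_eq0.
move: (2 ^+ (k + k.+1) : R) ('C(k + k.+1, k)%:R : R) (k`!%:R : R)
  (l ^+ k) (l ^+ k.+1) (expR _) e2 e3 e4 => u v w z s y u0 v0 w0.
by field; rewrite u0 v0 w0 e5.
Qed.

Lemma psummable_central_bin l : psummable l central_bin.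
Proof.
by apply: (@psummable_bounded _ _ 1) => k; rewrite ger0_norm ?central_bin_le1 ?central_bin_ge0.
Qed.

(* Given [K + L = n], the difference [K - L] is a simple random walk at time
   [n], whose return probabilities are the [central_bin n]. *)
Lemma pmean_collision l : 0 <= l ->
  pmean l (fun k => poisson_weight l k + prev_weight l k) =
  pmean (2 * l) central_bin.
Proof.
move=> l0; apply/cvg_lim => //; rewrite -cvg_shiftS.
(* Term [k] on the left gathers the terms [2k - 1] and [2k] on the right, so [n + 1] terms match
   [2n + 1] terms. *)
have -> : (fun n => series (fun k => (poisson_weight l k + prev_weight l k)
                                     * poisson_weight l k) n.+1) =
  (series (fun k => central_bin k * poisson_weight (2 * l) k)) \o (fun n => n.*2.+1).
  apply/funext => n /=.
  set G := fun k => (poisson_weight l k + _) * _; set H := fun k => central_bin k * _.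
  elim: n => [|n IHn].
    rewrite double0 /series/= !big_nat1 /G /H /= addr0.
    by rewrite -[0%N]double0 poisson_weight_double_even double0 expr2.
  rewrite (seriesSr G) IHn doubleS (seriesSr H n.*2.+2)
    (seriesSr H n.*2.+1) -[RHS]addrA.
  congr (_ + _); rewrite /H -[n.*2.+2]doubleS poisson_weight_double_odd.
  by rewrite poisson_weight_double_even /G /=; ring.
apply: cvg_comp (pmean_cvg (@psummable_central_bin (2 * l))).
apply/cvgnyPge => A; exists A => // n /= An.
by rewrite (leq_trans An)// -addnn -addnS leq_addr.
Qed.

Lemma psummable_affine l (a b : R) : psummable l (fun k => a + b * (k%:R - l)).
Proof.
apply: psummableD; first exact: psummable_cst.
by apply/psummableZ/psummableB; [exact: psummable_nat|exact: psummable_cst].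
Qed.

(** This turns a tangent line taken at the mean into Jensen's inequality. *)
Lemma pmean_affine l (a b : R) : pmean l (fun k => a + b * (k%:R - l)) = a.
Proof.
have s1 : psummable l (fun k => k%:R - l).
  by apply: psummableB; [exact: psummable_nat|exact: psummable_cst].
rewrite pmeanD ?pmeanZ ?pmeanB ?pmean_cst ?pmean_nat ?subrr ?mulr0 ?addr0//.
- exact: psummable_nat.
- exact: psummable_cst.
- exact: psummable_cst.
- exact: psummableZ.
Qed.

(** By the bounds on its square, [central_bin n] is equivalent to [c / sqrt n]. *)
Let c : R := Num.sqrt (2 / pi).

Let c_ge0 : 0 <= c. Proof. exact: sqrtr_ge0. Qed.

Let csqr : c ^+ 2 = 2 / pi.
Proof. by rewrite sqr_sqrtr// divr_ge0// pi_ge0. Qed.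

(* [1 / sqrt t] lies above its tangent at [t = u + 2], whose Poisson mean is its
   value there. *)
Lemma pmean_central_bin_ge u : 0 < u ->
  c / Num.sqrt (u + 2) <= pmean u central_bin.
Proof.
move=> u0; set s := Num.sqrt (u + 2).
have s0 : 0 < s by rewrite sqrtr_gt0 addr_gt0.
have ss : s ^+ 2 = u + 2 by rewrite sqr_sqrtr// ltW// addr_gt0.
rewrite -(pmean_affine u (c / s) (- (c / (2 * s ^+ 3)))).
apply: le_pmean; rewrite ?(ltW u0)//; first exact: psummable_affine.
  exact: psummable_central_bin.
move=> k; pose t : R := Num.sqrt (k%:R + 2).
have t0 : 0 < t by rewrite sqrtr_gt0 ltr_wpDl.
have tt : t ^+ 2 = k%:R + 2 by rewrite sqr_sqrtr// addr_ge0.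
apply: (@le_trans _ _ (c / t)).
  have -> : c / s + - (c / (2 * s ^+ 3)) * (k%:R - u) =
            c / t - c * ((t - s) ^+ 2 * (t + 2 * s) / (2 * s ^+ 3 * t)).
    have -> : k%:R - u = t ^+ 2 - s ^+ 2 by rewrite tt ss; ring.
    by field; rewrite !gt_eqF.
  rewrite gerBl mulr_ge0// divr_ge0//.
    by rewrite mulr_ge0 ?sqr_ge0// addr_ge0// ?mulr_ge0// ltW.
  by rewrite !mulr_ge0// ?exprn_ge0// ltW.
rewrite -(@ler_pXn2r _ 2)// ?nnegrE ?divr_ge0 ?central_bin_ge0// ?(ltW t0)//.
rewrite expr_div_n tt csqr -mulrA -invfM -natrD addn2.
exact: central_bin_sqr_ge.
Qed.

(* Here [sqrt t] lies below its tangent at [t = u + 3]; the factor [u] is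
   absorbed by Stein's identity. *)
Lemma pmean_central_bin_le u : 0 <= u ->
  u * pmean u central_bin <= c * Num.sqrt (u + 3).
Proof.
move=> u0; set s := Num.sqrt (u + 3).
have s0 : 0 < s by rewrite sqrtr_gt0 ltr_wpDl.
have ss : s ^+ 2 = u + 3 by rewrite sqr_sqrtr// addr_ge0.
rewrite -(@pmean_stein _ _ (fun k => central_bin k.-1)); last exact: psummable_central_bin.
rewrite -[leRHS](pmean_affine u _ (c / (2 * s))).
apply: le_pmean => //; last 2 first.
- exact: psummable_affine.
- move=> k; pose t : R := Num.sqrt (k%:R + 3).
  have t0 : 0 <= t by rewrite sqrtr_ge0.
  have tt : t ^+ 2 = k%:R + 3 by rewrite sqr_sqrtr// addr_ge0.
  apply: (@le_trans _ _ (c * t)); last first.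
    have -> : c * s + c / (2 * s) * (k%:R - u) = c * t + c * (t - s) ^+ 2 / (2 * s).
      have -> : k%:R - u = t ^+ 2 - s ^+ 2 by rewrite tt ss; ring.
      by field; rewrite !gt_eqF.
    by rewrite lerDl divr_ge0// mulr_ge0 ?sqr_ge0 ?(ltW s0).
  rewrite -(@ler_pXn2r _ 2)// ?nnegrE ?mulr_ge0 ?central_bin_ge0//.
  rewrite (exprMn _ _ (central_bin _)) (exprMn _ c) tt csqr.
  have pi0 : 0 < pi :> R := pi_gt0 R.
  (* The Wallis upper bound covers [central_bin k.-1] only for [k >= 2]. At [k = 0] the left side
     vanishes, and at [k = 1] it is 1, below 8 / pi. *)
  case: k t t0 tt => [|[|k]] t t0 tt.
  + rewrite expr0n/= mul0r; apply: mulr_ge0; last exact: addr_ge0.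
    by apply: divr_ge0 => //; exact: ltW.
  + rewrite /= /central_bin bin0 expr0 divr1 !expr1n mul1r mulrAC ler_pdivlMr// mul1r.
    have : pi / 2 < 2 :> R := pihalf_lt2 R.
    by move: (@pi R) pi0 => p p0; lra.
  + apply: (le_trans (ler_wpM2l (exprn_ge0 2 _) (central_bin_sqr_le k))) => //.
    have -> : k.+2%:R ^+ 2 * (2 / (pi * k.+1%:R)) = 2 / pi * (k.+2%:R ^+ 2 / k.+1%:R) :> R.
      by rewrite invfM [2 / pi]mulrC; ring.
    rewrite ler_pM2l ?divr_gt0//.
    rewrite ler_pdivrMr ?ltr0n// -natrD -natrM -natrX ler_nat.
    by rewrite -mulnn; nia.
- apply: (@psummable_stein _ _ (fun k => central_bin k.-1)).
  exact: psummable_central_bin.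
Qed.

Lemma poisson_excess_ge l : 0 < l ->
  l * (c / Num.sqrt (2 * l + 2)) <= poisson_excess l.
Proof.
move=> l0; rewrite poisson_excessE ?pmean_collision ?(ltW l0)//.
by rewrite ler_pM2l// pmean_central_bin_ge// mulr_gt0.
Qed.

Lemma poisson_excess_le l : 0 <= l ->
  poisson_excess l <= c / 2 * Num.sqrt (2 * l + 3).
Proof.
move=> l0; rewrite poisson_excessE ?pmean_collision//.
have := pmean_central_bin_le (mulr_ge0 (ler0n _ 2) l0).
move: (pmean _ _) (Num.sqrt _) c => A B c1; lra.
Qed.

Lemma poisson_excess_ge0 l : 0 <= l -> 0 <= poisson_excess l.
Proof.
move=> l0; rewrite poisson_excessE ?pmean_collision// mulr_ge0// pmean_ge0 ?mulr_ge0//.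
  exact: psummable_central_bin.
exact: central_bin_ge0.
Qed.

Lemma poisson_excess0 : poisson_excess 0 = 0.
Proof. by rewrite poisson_excessE// mul0r. Qed.

Let half_c_sqrt (x : R) : 0 <= x -> c / 2 * Num.sqrt (2 * x) = Num.sqrt (x / pi).
Proof.
move=> x0; have pi0 := pi_gt0 R.
apply/eqP; rewrite -(@eqrXn2 _ 2)// ?mulr_ge0 ?divr_ge0 ?sqrtr_ge0//.
rewrite !exprMn csqr !sqr_sqrtr ?divr_ge0 ?mulr_ge0 ?(ltW pi0)//.
by apply/eqP; move: (@pi R) pi0 => p p0; field; rewrite gt_eqF.
Qed.

(** Once [sqrt m] is factored out, the shifts 2 and 3 in the two bounds become [2 / m] and [3 / m],
    so both bounds share one limit. The lower bound needs a positive mean, hence the separate case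
    [x = 0]. *)
Lemma cvg_poisson_excess (x : R) : 0 <= x ->
  poisson_excess (m%:R * x) / Num.sqrt m%:R @[m --> \oo] --> Num.sqrt (x / pi).
Proof.
rewrite le_eqVlt => /predU1P[<-|x0].
  rewrite mul0r sqrtr0; under eq_fun do rewrite mulr0 poisson_excess0 mul0r.
  exact: cvg_cst.
have invm0 : (m%:R^-1 : R) @[m --> \oo] --> 0.
  by apply/gtr0_cvgV0; [exists 1%N => // m /= m0; rewrite ltr0n|exact: cvgr_idn].
have cvgs (b : R) : Num.sqrt (2 * x + b * m%:R^-1) @[m --> \oo] --> Num.sqrt (2 * x).
  apply: continuous_cvg; first exact: sqrt_continuous.
  rewrite -[X in _ --> X]addr0; apply: cvgD; first exact: cvg_cst.
  by rewrite -(mulr0 b); apply: cvgM => //; exact: cvg_cst.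
have s0 : 0 < Num.sqrt (2 * x) by rewrite sqrtr_gt0 mulr_gt0.
have sm (m : nat) b : (0 < m)%N -> 0 <= b ->
    Num.sqrt (2 * (m%:R * x) + b) = Num.sqrt m%:R * Num.sqrt (2 * x + b * m%:R^-1).
  move=> m0 b0; rewrite -sqrtrM//; congr Num.sqrt.
  by field; rewrite pnatr_eq0 -lt0n.
apply: (@squeeze_cvgr _ _ _ _ (fun m => x * (c / Num.sqrt (2 * x + 2 * m%:R^-1)))
                              (fun m => c / 2 * Num.sqrt (2 * x + 3 * m%:R^-1))).
- exists 1%N => // m /= m0.
  have m1 : 0 < m%:R :> R by rewrite ltr0n.
  have smm : 0 < Num.sqrt m%:R :> R by rewrite sqrtr_gt0.
  apply/andP; split.
    rewrite ler_pdivlMr//; apply: le_trans (poisson_excess_ge _); last exact: mulr_gt0.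
    rewrite sm// invfM le_eqVlt; apply/orP; left; apply/eqP.
    rewrite -[X in _ = X * _ * _](@sqr_sqrtr _ m%:R)//.
    have s1 : 0 < Num.sqrt (2 * x + 2 * m%:R^-1).
      by rewrite sqrtr_gt0 addr_gt0 ?mulr_gt0 ?invr_gt0.
    move: (Num.sqrt m%:R) (Num.sqrt (2 * x + 2 * m%:R^-1)) smm s1 => y z y0 z0.
    by field; rewrite !gt_eqF.
  rewrite ler_pdivrMr// (le_trans (poisson_excess_le _))//; first by rewrite mulr_ge0 ?ltW.
  by rewrite sm// le_eqVlt; apply/orP; left; apply/eqP; ring.
- have -> : Num.sqrt (x / pi) = x * (c / Num.sqrt (2 * x)).
    rewrite -half_c_sqrt ?(ltW x0)//.
    have : Num.sqrt (2 * x) ^+ 2 = 2 * x by rewrite sqr_sqrtr// mulr_ge0// ltW.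
    move: (Num.sqrt (2 * x)) s0 => s s0 ss.
    have -> : x = s ^+ 2 / 2 by rewrite ss mulrC mulKf.
    by field; rewrite gt_eqF.
  apply: cvgM; first exact: cvg_cst.
  by apply: cvgM; [exact: cvg_cst|apply: cvgV; rewrite ?gt_eqF].
- rewrite -half_c_sqrt ?(ltW x0)//.
  by apply: cvgM; [exact: cvg_cst|exact: cvgs].
Qed.

End PoissonExcess.

(** * Taylor expansions on the half-line *)

Section HalfLineTaylor.
Context {R : realType}.
Implicit Types (g : R -> R) (x y : R).

(** Clearing the denominator admits [y = x] and leaves [0 <= y] as the only trace of one-sidedness,
    so that 0 is treated like any other point. *)
Lemma derivative_ge0_approx g (g' : R -> R) x (e : R) :
  derivative_ge0 g g' -> 0 <= x -> 0 < e ->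
  exists2 d : R, 0 < d & forall y, 0 <= y -> `|y - x| < d ->
    `|g y - g x - g' x * (y - x)| <= e * `|y - x|.
Proof.
move=> dg x0 e0; have /cvgrPdist_le/(_ _ e0) := dg x x0.
rewrite near_withinE => -[d /= d0 dP]; exists d => // y y0 yxd.
have [->|yx] := eqVneq y x; first by rewrite !subrr mulr0 subrr normr0 mulr0.
have yx0 : y - x != 0 by rewrite subr_eq0.
have := dP y; rewrite /= distrC => /(_ yxd yx).
rewrite in_itv/= andbT => /(_ y0) H.
rewrite -ler_pdivrMr ?normr_gt0// -normfV -normrM mulrBl mulfK// distrC.
exact: H.
Qed.

Lemma derivative_ge0_is_derive g (g' : R -> R) x : derivative_ge0 g g' -> 0 < x ->
  is_derive x 1 g (g' x).
Proof.
move=> dg x0.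
have H : (fun h => h^-1 *: ((g \o shift x) (h *: 1) - g x)) @ 0^' --> g' x.
  apply/cvgrPdist_le => e e0.
  have [d d0 dP] := derivative_ge0_approx dg (ltW x0) e0.
  near=> h.
  have h0 : h != 0 by near: h; exact: nbhs_dnbhs_neq.
  have hd : `|h| < d by near: h; exact: dnbhs0_lt.
  have hx : `|h| < x by near: h; exact: dnbhs0_lt.
  have hx0 : 0 <= h + x.
    by move: hx; rewrite ltr_norml => /andP[]; rewrite ltrNl => /ltW; lra.
  have := dP (h + x) hx0; rewrite addrK => /(_ hd) Hh.
  rewrite /= /GRing.scale/= mulr1 distrC.
  rewrite -(ler_pM2r (_ : 0 < `|h|)) ?normr_gt0// -normrM mulrBl mulrAC mulVf// mul1r.
  exact: Hh.
by apply: DeriveDef; [exact: (cvgP _ H)|exact: cvg_lim].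
Unshelve. all: by end_near. Qed.

Lemma derivative_ge0_continuous g (g' : R -> R) : derivative_ge0 g g' ->
  {within `[0, +oo[, continuous g}.
Proof.
move=> dg; apply/subspace_continuousP => z /=; rewrite in_itv/= andbT => z0.
apply/cvgrPdist_le => e e0.
have [d d0 dP] := derivative_ge0_approx dg z0 ltr01.
have k0 : 0 < 1 + `|g' z| by rewrite ltr_pwDl.
rewrite near_withinE; near=> t => /=; rewrite in_itv/= andbT => t0.
have td : `|t - z| < d by rewrite distrC; near: t; exact: (nbhsx_ballx z d d0).
have te : `|t - z| < e / (1 + `|g' z|).
  by rewrite distrC; near: t; exact: (nbhsx_ballx z _ (divr_gt0 e0 k0)).
have := dP t t0 td; rewrite mul1r => H.
rewrite distrC -(subrK (g' z * (t - z)) (g t - g z)) (le_trans (ler_normD _ _))//.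
rewrite (le_trans (lerD H (lexx _)))// normrM.
by move: (ltW te); rewrite ler_pdivlMr// mulrDr mulr1 [_ * `|g' z|]mulrC.
Unshelve. all: by end_near. Qed.

(** A two-sided derivative is needed only inside the segment, so the endpoint 0 enters through
    continuity alone. Bounding the distance from [c] to [x] spares a distinction on the order of [x]
    and [y]. *)
Lemma mean_value_ge0 g (g' : R -> R) x y : derivative_ge0 g g' -> 0 <= x -> 0 <= y ->
  exists c, [/\ 0 <= c, `|c - x| <= `|y - x| & g y - g x = g' c * (y - x)].
Proof.
move=> dg x0 y0; have cg := derivative_ge0_continuous dg.
have mvt (s t : R) : 0 <= s -> s <= t ->
    exists2 c, c \in `[s, t]%R & g t - g s = g' c * (t - s).
  move=> s0 st; apply: MVT_segment => //.
    move=> z; rewrite in_itv/= => /andP[sz _].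
    by apply: derivative_ge0_is_derive => //; exact: le_lt_trans sz.
  apply: continuous_subspaceW cg => z /=; rewrite !in_itv/= andbT => /andP[sz _].
  exact: le_trans sz.
have [xy|/ltW yx] := leP x y.
- have [c + e] := mvt _ _ x0 xy; rewrite in_itv/= => /andP[xc cy].
  exists c; split => //; first exact: le_trans xc.
  by rewrite !ger0_norm ?subr_ge0// lerB.
- have [c + e] := mvt _ _ y0 yx; rewrite in_itv/= => /andP[yc cx].
  exists c; split; first exact: le_trans yc.
  + by rewrite !ler0_norm ?subr_le0// lerN2 lerB.
  + by rewrite -[LHS]opprB e -mulrN opprB.
Qed.

End HalfLineTaylor.

Section CdfTaylor.
Context {R : realType} (F f f' : R -> R) (M : R).
Context (F_derivative : derivative_ge0 F f) (f_derivative : derivative_ge0 f f').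
Context (f'_le : forall x, 0 <= x -> `|f' x| <= M).

(** The mean value theorem is used twice, for [F] and then for [f]. The sharp constant would be
    [M / 2]; the loss affects no rate. *)
Lemma taylor1 x y : 0 <= x -> 0 <= y ->
  `|F y - F x - f x * (y - x)| <= M * (y - x) ^+ 2.
Proof.
move=> x0 y0.
have [c [c0 cx ->]] := mean_value_ge0 F_derivative x0 y0.
have [c' [c'0 c'x fE]] := mean_value_ge0 f_derivative x0 c0.
rewrite -mulrBl fE !normrM -(real_normK (num_real (y - x))) expr2 mulrA.
by rewrite ler_wpM2r// ler_pM// f'_le.
Qed.

(** Near [x], the derivative of the remainder is the first-order error of [f] at [x], so one use of
    the mean value theorem suffices. The estimate must hold for all [y >= 0], since it is averaged
    over the whole grid. *)
Lemma taylor2 x (e : R) : 0 <= x -> 0 < e ->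
  exists2 C : R, 0 <= C & forall y, 0 <= y ->
   `|F y - F x - f x * (y - x) - f' x / 2 * (y - x) ^+ 2|
     <= e * (y - x) ^+ 2 + C * (y - x) ^+ 4.
Proof.
move=> x0 e0.
have M0 : 0 <= M by rewrite (le_trans _ (f'_le (lexx 0))).
have [d d0 dP] := derivative_ge0_approx f_derivative x0 e0.
exists ((M + M) / d ^+ 2) => [|y y0].
  by rewrite divr_ge0 ?addr_ge0 ?sqr_ge0.
have [yxd|dyx] := ltP `|y - x| d.
  rewrite -[leLHS]addr0 lerD//; last first.
    by rewrite mulr_ge0 ?divr_ge0 ?addr_ge0 ?sqr_ge0// (exprn_even_ge0).
  pose g z := F z - f x * (z - x) - f' x / 2 * (z - x) ^+ 2.
  pose g' z := f z - f x - f' x * (z - x).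
  have dg : derivative_ge0 g g'.
    move=> z z0.
    (* The difference quotient of (t - x)^2 at [z] is t + z - 2x; giving the target the same shape
       lets the limit be taken term by term. *)
    rewrite (_ : g' z = f z - (f x + f' x / 2 * (z + z - x - x))); last by rewrite /g'; field.
    apply: (@cvg_trans _ ((F t - F z) / (t - z) - (f x + f' x / 2 * (t + z - x - x))
        @[t --> within `[0, +oo[ z^'])).
      apply: near_eq_cvg; rewrite near_withinE; near=> t => _.
      have tz : t - z != 0 by rewrite subr_eq0; near: t; exact: nbhs_dnbhs_neq.
      by rewrite /g; field.
    apply: cvgB; first exact: F_derivative.
    apply: cvgD; first exact: cvg_cst.
    apply: cvgM; first exact: cvg_cst.
    apply: cvgB; last exact: cvg_cst.
    apply: cvgB; last exact: cvg_cst.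
    apply: cvgD; last exact: cvg_cst.
    by apply: cvg_within_filter; exact: nbhs_dnbhs.
  have [c [c0 cx gE]] := mean_value_ge0 dg x0 y0.
  have -> : F y - F x - f x * (y - x) - f' x / 2 * (y - x) ^+ 2 = g y - g x.
    by rewrite /g subrr; ring.
  rewrite gE normrM -(real_normK (num_real (y - x))) expr2 mulrA ler_wpM2r//.
  by rewrite (le_trans (dP _ c0 (le_lt_trans cx yxd)))// ler_pM2l.
(* Far from [x] the quadratic bound is absorbed by the quartic term, whose
   Poisson mean is of order [m^-2]. *)
have h1 : `|F y - F x - f x * (y - x) - f' x / 2 * (y - x) ^+ 2| <= (M + M) * (y - x) ^+ 2.
  rewrite mulrDl (le_trans (ler_normB _ _))// lerD ?taylor1//.
  rewrite normrM [X in _ * X]ger0_norm ?sqr_ge0// ler_wpM2r ?sqr_ge0//.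
  rewrite normrM normfV normr_nat ler_pdivrMr// (le_trans (f'_le x0))//.
  by rewrite ler_peMr// ler1n.
apply: (le_trans h1); rewrite -[leLHS]add0r; apply: lerD.
  by rewrite mulr_ge0 ?sqr_ge0 ?(ltW e0).
rewrite mulrAC -mulrA ler_wpM2l ?addr_ge0// ler_pdivlMr ?exprn_gt0//.
rewrite -[4%N]/(2 + 2)%N exprD ler_wpM2l ?sqr_ge0//.
by rewrite -(real_normK (num_real (y - x))) ler_pXn2r// ?nnegrE// ltW.
Unshelve. all: by end_near. Qed.

End CdfTaylor.

(** * Pointwise asymptotics of the bias and of the variance *)

Section SzaszOperator.
Context {R : realType}.
Implicit Types (F : R -> R) (x : R).

Definition szasz F m x : R := pmean (m%:R * x) (fun k => F (k%:R / m%:R)).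

Definition szasz_min F m x : R :=
  pmean (m%:R * x) (fun k => pmean (m%:R * x) (fun j => F ((minn k j)%:R / m%:R))).

Definition szasz_bias F m x : R := szasz F m x - F x.

(* [n] times the variance of the Szasz estimator at [x]. *)
Definition szasz_var F m x : R := szasz_min F m x - szasz F m x ^+ 2.

Let gridE m x k : (0 < m)%N -> k%:R / m%:R - x = (k%:R - m%:R * x) / m%:R.
Proof. by move=> m0; rewrite mulrBl [m%:R * x]mulrC mulfK// pnatr_eq0 -lt0n. Qed.

Lemma psummable_centered m x n : (0 < m)%N ->
  psummable (m%:R * x) (fun k => (k%:R / m%:R - x) ^+ n).
Proof.
move=> m0.
have -> : (fun k : nat => (k%:R / m%:R - x) ^+ n) =
          (fun k => m%:R^-1 ^+ n * (k%:R + - (m%:R * x)) ^+ n).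
  by apply/funext => k; rewrite gridE// exprMn mulrC.
exact/psummableZ/psummable_expn.
Qed.

Let pmean_centeredX m x n : (0 < m)%N ->
  pmean (m%:R * x) (fun k => (k%:R / m%:R - x) ^+ n) =
  m%:R^-1 ^+ n * pmean (m%:R * x) (fun k => (k%:R - m%:R * x) ^+ n).
Proof.
move=> m0; rewrite -pmeanZ; last exact: psummable_expn.
by apply: eq_pmean => k; rewrite gridE// exprMn mulrC.
Qed.

Lemma pmean_grid_centered m x : (0 < m)%N ->
  pmean (m%:R * x) (fun k => k%:R / m%:R - x) = 0.
Proof.
move=> m0; rewrite -[RHS](pmean_affine (m%:R * x) 0 m%:R^-1).
by apply: eq_pmean => k; rewrite gridE// add0r mulrC.
Qed.

Lemma pmean_grid_centered2 m x : (0 < m)%N ->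
  pmean (m%:R * x) (fun k => (k%:R / m%:R - x) ^+ 2) = x / m%:R.
Proof.
move=> m0; rewrite pmean_centeredX// pmean_centered2.
by field; rewrite pnatr_eq0 -lt0n.
Qed.

Lemma pmean_grid_centered4 m x : (0 < m)%N ->
  pmean (m%:R * x) (fun k => (k%:R / m%:R - x) ^+ 4) =
  x / m%:R ^+ 3 + 3 * x ^+ 2 / m%:R ^+ 2.
Proof.
move=> m0; rewrite pmean_centeredX// pmean_centered4.
by field; rewrite pnatr_eq0 -lt0n.
Qed.

End SzaszOperator.

Section SzaszAsymptotics.
Context {R : realType} (F f f' : R -> R) (M : R).
Context (F_derivative : derivative_ge0 F f) (f_derivative : derivative_ge0 f f').
Context (f'_le : forall x, 0 <= x -> `|f' x| <= M).
Context (F_range : forall x, 0 <= F x <= 1).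

Let normF x : `|F x| <= 1.
Proof. by have /andP[F0 F1] := F_range x; rewrite ger0_norm. Qed.

Let sF l (s : nat -> R) : psummable l (fun k => F (s k)).
Proof. by apply: (@psummable_bounded _ _ 1) => k. Qed.

Let M_ge0 : 0 <= M. Proof. exact: le_trans (f'_le (lexx 0)). Qed.

Let grid_ge0 (k m : nat) : 0 <= k%:R / m%:R :> R. Proof. by rewrite divr_ge0. Qed.

(** The centered first moment vanishes and the second is [x / m], so [c1] is free and [c2] costs
    [c2 * (x / m)]. Choosing [c2 = 0] gives the uniform bound, [c2 = f' x / 2] the limit. *)
Lemma szasz_biasE m x (c1 c2 : R) : (0 < m)%N ->
  szasz_bias F m x = pmean (m%:R * x) (fun k => F (k%:R / m%:R) - F x
    - c1 * (k%:R / m%:R - x) - c2 * (k%:R / m%:R - x) ^+ 2) + c2 * (x / m%:R).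
Proof.
move=> m0.
have s1 : psummable (m%:R * x) (fun k => k%:R / m%:R - x) by exact: (@psummable_centered _ _ _ 1).
have s2 := @psummable_centered _ _ x 2 m0.
have sc := @psummable_cst _ (m%:R * x) (F x).
have sd : psummable (m%:R * x) (fun k => F (k%:R / m%:R) - F x).
  by apply: psummableB => //; exact: (@sF _ (fun k => k%:R / m%:R)).
have sd1 : psummable (m%:R * x) (fun k => F (k%:R / m%:R) - F x - c1 * (k%:R / m%:R - x)).
  by apply: psummableB => //; exact: psummableZ.
rewrite pmeanB//; last exact: psummableZ.
rewrite pmeanB//; last exact: psummableZ.
rewrite pmeanB//.
rewrite (pmeanZ c2 s2) (pmeanZ c1 s1).
by rewrite pmean_cst pmean_grid_centered// pmean_grid_centered2// mulr0 subr0 subrK.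
Qed.

Lemma szasz_bias_le m x : (0 < m)%N -> 0 <= x ->
  `|szasz_bias F m x| <= M * (x / m%:R).
Proof.
move=> m0 x0; rewrite (szasz_biasE _ (f x) 0 m0) mul0r addr0.
have s2 := @psummable_centered _ _ x 2 m0.
rewrite -(@pmean_grid_centered2 _ m x m0) -pmeanZ//.
apply: ler_norm_pmean; [by rewrite mulr_ge0|exact: psummableZ|].
by move=> k; rewrite mul0r subr0 (taylor1 F_derivative f_derivative).
Qed.

Lemma cvg_szasz_bias x : 0 <= x ->
  m%:R * szasz_bias F m x @[m --> \oo] --> x * f' x / 2.
Proof.
move=> x0; apply/cvgrPdist_le => e e0.
(* Chosen so that [e1 * x + e1 = e]: the second moment uses [e1 * x], and the quartic term falls
   below [e1] for large [m]. *)
pose e1 := e / (x + 1).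
have x1 : 0 < x + 1 by rewrite ltr_wpDl.
have e10 : 0 < e1 by rewrite divr_gt0.
have [C C0 HC] := taylor2 F_derivative f_derivative f'_le x0 e10.
near=> m.
have m0 : (0 < m)%N by near: m; exists 1%N.
have m1 : 0 < m%:R :> R by rewrite ltr0n.
have m1' : m%:R != 0 :> R by rewrite gt_eqF.
rewrite distrC (szasz_biasE _ (f x) (f' x / 2) m0) mulrDr.
have -> : m%:R * (f' x / 2 * (x / m%:R)) = x * f' x / 2 by field.
rewrite addrK normrM ger0_norm//.
have s2 := @psummable_centered _ _ x 2 m0.
have s4 := @psummable_centered _ _ x 4 m0.
have H : `|pmean (m%:R * x) (fun k => F (k%:R / m%:R) - F x
    - f x * (k%:R / m%:R - x) - f' x / 2 * (k%:R / m%:R - x) ^+ 2)| <=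
    e1 * (x / m%:R) + C * (x / m%:R ^+ 3 + 3 * x ^+ 2 / m%:R ^+ 2).
  rewrite -(@pmean_grid_centered2 _ m x m0) -(@pmean_grid_centered4 _ m x m0) -(pmeanZ e1 s2)
    -(pmeanZ C s4) -pmeanD; try exact: psummableZ.
  apply: ler_norm_pmean; first by rewrite mulr_ge0.
    by apply: psummableD; exact: psummableZ.
  by move=> k; exact: HC.
apply: (le_trans (ler_wpM2l (ltW m1) H)).
have -> : e = e1 * x + e1 by rewrite -[X in _ + X]mulr1 -mulrDr divfK ?gt_eqF.
have -> : m%:R * (e1 * (x / m%:R) + C * (x / m%:R ^+ 3 + 3 * x ^+ 2 / m%:R ^+ 2)) =
   e1 * x + C * (x / m%:R + 3 * x ^+ 2) / m%:R by field.
rewrite lerD2l ler_pdivrMr//.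
apply: (@le_trans _ _ (C * (x + 3 * x ^+ 2))).
  by rewrite ler_wpM2l// lerD2r ler_pdivrMr// ler_peMr// ler1n.
rewrite -ler_pdivrMl// mulrC.
near: m; exact: nbhs_infty_ger.
Unshelve. all: by end_near. Qed.

(** Of the constant 4, the quadratic Taylor remainder at the minimum accounts for 2 and the
    replacement of the squared mean by [F x ^+ 2] for the other 2. *)
Lemma szasz_var_approx m x : (0 < m)%N -> 0 <= x ->
  `|szasz_var F m x - sigma2 F x + f x * (poisson_excess (m%:R * x) / m%:R)|
    <= 4 * M * (x / m%:R).
Proof.
move=> m0 x0; set l := m%:R * x.
have l0 : 0 <= l by rewrite mulr_ge0.
have m1 : 0 < m%:R :> R by rewrite ltr0n.
have m1' : m%:R != 0 :> R by rewrite gt_eqF.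
pose u (k : nat) := k%:R / m%:R - x.
pose I (k : nat) : R := pmean l (fun j => (k - j)%N%:R).
pose G (k : nat) := pmean l (fun j => F ((minn k j)%:R / m%:R)).
have s2 := @psummable_centered _ _ x 2 m0.
have sI k : psummable l (fun j => (k - j)%N%:R).
  by apply: (@psummable_bounded _ _ k%:R) => j; rewrite ger0_norm// ler_nat leq_subr.
have sII : psummable l I.
  apply: psummable_le (@psummable_nat R l) => k.
  rewrite [leRHS]ger0_norm// -[leRHS](pmean_cst l).
  apply: ler_norm_pmean => //; first exact: psummable_cst.
  by move=> j; rewrite ger0_norm// ler_nat leq_subr.
have sG : psummable l G.
  apply: (@psummable_bounded _ _ 1) => k; rewrite -[leRHS](pmean_cst l).
  by apply: ler_norm_pmean => //; exact: psummable_cst.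
(* [min(K, L) = K - (K - L)^+] turns the linear term of the expansion of
   [E F(min(K, L) / m)] into [poisson_excess]. *)
have minE k j : (minn k j)%:R / m%:R - x = u k - (k - j)%N%:R / m%:R.
  by rewrite minnE /u natrB ?leq_subr//; ring.
have GE k : `|G k - F x - f x * (u k - I k / m%:R)| <= M * (u k ^+ 2 + x / m%:R).
  have -> : G k - F x - f x * (u k - I k / m%:R) =
    pmean l (fun j => F ((minn k j)%:R / m%:R) - F x -
       f x * ((minn k j)%:R / m%:R - x)).
    rewrite [RHS](@eq_pmean _ _ _ (fun j => F ((minn k j)%:R / m%:R) - F x -
       (f x * u k - f x / m%:R * (k - j)%N%:R))); last by move=> j; rewrite minE; ring.
    have sFm : psummable l (fun j => F ((minn k j)%:R / m%:R)).
      exact: (@sF _ (fun j => (minn k j)%:R / m%:R)).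
    rewrite pmeanB; last 2 first.
    - by apply: psummableB => //; exact: psummable_cst.
    - by apply: psummableB; [exact: psummable_cst|exact: psummableZ].
    rewrite pmeanB//.
    rewrite pmeanB; [|exact: psummable_cst|exact: psummableZ].
    by rewrite (pmeanZ _ (sI k)) !pmean_cst -/(G k) -/(I k); ring.
  rewrite -(@pmean_grid_centered2 _ m x m0) -[in leRHS](pmean_cst l (u k ^+ 2)) -pmeanD//; last exact: psummable_cst.
  rewrite -pmeanZ; last by apply: psummableD => //; exact: psummable_cst.
  apply: ler_norm_pmean => //.
    by apply/psummableZ/psummableD => //; exact: psummable_cst.
  move=> j; rewrite (le_trans (taylor1 F_derivative f_derivative f'_le x0 _))//.
  (* The minimum is one of the two grid points, so its squared deviation is at most the sum of
     both. *)
  rewrite ler_wpM2l// /minn; case: ifP => _.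
    by rewrite lerDl sqr_ge0.
  by rewrite lerDr sqr_ge0.
have su : psummable l u by exact: (@psummable_centered _ _ _ 1).
have H1 : `|szasz_min F m x - F x + f x * (poisson_excess l / m%:R)| <= M * (x / m%:R + x / m%:R).
  have -> : szasz_min F m x - F x + f x * (poisson_excess l / m%:R) =
    pmean l (fun k => G k - F x - f x * (u k - I k / m%:R)).
    rewrite [RHS](@eq_pmean _ _ _ (fun k => G k - F x -
       (f x * u k - f x / m%:R * I k))); last by move=> k; ring.
    rewrite pmeanB; last 2 first.
    - by apply: psummableB => //; exact: psummable_cst.
    - by apply: psummableB; exact: psummableZ.
    rewrite pmeanB//.
    rewrite pmeanB; [|exact: psummableZ|exact: psummableZ].
    rewrite (pmeanZ _ su) (pmeanZ _ sII) !pmean_cst.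
    by rewrite pmean_grid_centered// -/(szasz_min F m x) -/(poisson_excess l); ring.
  rewrite -{1}(@pmean_grid_centered2 _ m x m0) -[X in _ * (_ + X)](pmean_cst l) -pmeanD//; last exact: psummable_cst.
  rewrite -pmeanZ; last by apply: psummableD => //; exact: psummable_cst.
  apply: ler_norm_pmean => //.
  by apply/psummableZ/psummableD => //; exact: psummable_cst.
have H2 : `|szasz F m x ^+ 2 - F x ^+ 2| <= M * (x / m%:R) * 2.
  rewrite subr_sqr normrM ler_pM// ?szasz_bias_le//.
  rewrite (le_trans (ler_normD _ _))// -[leRHS]/(1 + 1) lerD//.
  rewrite -[leRHS](pmean_cst l).
  by apply: ler_norm_pmean => //; exact: psummable_cst.
have -> : szasz_var F m x - sigma2 F x + f x * (poisson_excess l / m%:R) =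
  (szasz_min F m x - F x + f x * (poisson_excess l / m%:R)) - (szasz F m x ^+ 2 - F x ^+ 2).
  by rewrite /szasz_var /sigma2; ring.
rewrite (le_trans (ler_normB _ _))// (le_trans (lerD H1 H2))// le_eqVlt.
by apply/orP; left; apply/eqP; ring.
Qed.

(** Multiplied by [sqrt m], the error [4 * M * (x / m)] vanishes and only the excess term
    survives. *)
Lemma cvg_szasz_var x : 0 <= x ->
  Num.sqrt m%:R * (szasz_var F m x - sigma2 F x) @[m --> \oo] --> - VS f x.
Proof.
move=> x0.
pose D m := szasz_var F m x - sigma2 F x + f x * (poisson_excess (m%:R * x) / m%:R).
have sqrt_oo : (Num.sqrt m%:R)^-1 @[m --> \oo] --> (0 : R).
  have /(continuous_cvg _ (@sqrt_continuous R _)) : (m%:R^-1 : R) @[m --> \oo] --> 0.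
    by apply/gtr0_cvgV0; [exists 1%N => // m /= m0; rewrite ltr0n|exact: cvgr_idn].
  rewrite sqrtr0; apply: cvg_trans; apply: near_eq_cvg.
  by apply: nearW => m; rewrite /= sqrtrV.
have D0 : Num.sqrt m%:R * D m @[m --> \oo] --> 0.
  apply/norm_cvg0P/(@squeeze_cvgr _ _ _ _ (fun=> 0) (fun m => 4 * M * x * (Num.sqrt m%:R)^-1)).
  - exists 1%N => // m /= m0; rewrite normr_ge0/= normrM ger0_norm ?sqrtr_ge0//.
    have m1 : 0 < m%:R :> R by rewrite ltr0n.
    have sm0 : 0 < Num.sqrt m%:R :> R by rewrite sqrtr_gt0.
    apply: (le_trans (ler_wpM2l (sqrtr_ge0 _) (szasz_var_approx m0 x0))).
    have : Num.sqrt m%:R ^+ 2 = m%:R :> R by rewrite sqr_sqrtr// ltW.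
    move: (Num.sqrt m%:R) sm0 => s s0 <-.
    by rewrite le_eqVlt; apply/orP; left; apply/eqP; field; rewrite gt_eqF.
  - exact: cvg_cst.
  - by rewrite -(mulr0 (4 * M * x)); apply: cvgM => //; exact: cvg_cst.
have -> : - VS f x = 0 - f x * Num.sqrt (x / pi) by rewrite sub0r.
apply: (@cvg_trans _ (Num.sqrt m%:R * D m -
    f x * (poisson_excess (m%:R * x) / Num.sqrt m%:R) @[m --> \oo])).
  apply: near_eq_cvg; exists 1%N => // m /= m0; rewrite /D.
  have m1 : 0 < m%:R :> R by rewrite ltr0n.
  have sm0 : 0 < Num.sqrt m%:R :> R by rewrite sqrtr_gt0.
  have e : Num.sqrt m%:R / m%:R = (Num.sqrt m%:R)^-1 :> R.
    have : Num.sqrt m%:R ^+ 2 = m%:R :> R by rewrite sqr_sqrtr// ltW.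
    by move: (Num.sqrt m%:R) sm0 => s s0 <-; field; rewrite gt_eqF.
  by rewrite mulrDr -e; ring.
apply: cvgB => //; apply: cvgM; first exact: cvg_cst.
exact: cvg_poisson_excess.
Qed.

(** This is the domination for the preceding limit. With [m >= 1], the excess is at most
    [sqrt m * (2 * x + 3)], crude in [x] but of the right order in [m]. *)
Lemma szasz_var_le m x (Mf : R) : (0 < m)%N -> 0 <= x -> `|f x| <= Mf ->
  `|Num.sqrt m%:R * (szasz_var F m x - sigma2 F x)| <= (4 * M + 3 * Mf) * (1 + x).
Proof.
move=> m0 x0 fM; have Mf0 : 0 <= Mf by exact: le_trans fM.
have m1 : 1 <= m%:R :> R by rewrite ler1n.
have m1' : 0 < m%:R :> R by rewrite ltr0n.
have s1 : 1 <= Num.sqrt m%:R :> R by rewrite -[leLHS]sqrtr1 ler_wsqrtr.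
have s0 : 0 < Num.sqrt m%:R :> R by exact: lt_le_trans s1.
have ss : Num.sqrt m%:R ^+ 2 = m%:R :> R by rewrite sqr_sqrtr// ltW.
have l0 : 0 <= m%:R * x by rewrite mulr_ge0.
have ex : poisson_excess (m%:R * x) <= Num.sqrt m%:R * (2 * x + 3).
  apply: (le_trans (poisson_excess_le l0)).
  rewrite -[leRHS]mul1r; apply: ler_pM; rewrite ?divr_ge0 ?sqrtr_ge0//.
    rewrite ler_pdivrMr// mul1r (@le_trans _ _ 1) ?ler1n//.
    rewrite -[leRHS]sqrtr1 ler_wsqrtr// ler_pdivrMr ?pi_gt0// mul1r.
    exact: pi_ge2.
  apply: (@le_trans _ _ (Num.sqrt (m%:R * (2 * x + 3) ^+ 2))).
    rewrite ler_wsqrtr//; apply: (@le_trans _ _ (m%:R * (2 * x + 3))).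
      by rewrite mulrDr mulrCA lerD2l ler_peMl.
    by rewrite ler_wpM2l// expr2 ler_peMr; lra.
  by rewrite sqrtrM ?(ltW m1')// sqrtr_sqr ger0_norm// addr_ge0 ?mulr_ge0.
have e (y : R) : Num.sqrt m%:R * (y / m%:R) = y / Num.sqrt m%:R.
  by move: (Num.sqrt m%:R) s0 ss => s s0 <-; field; rewrite gt_eqF.
have H := szasz_var_approx m0 x0.
have sV : szasz_var F m x - sigma2 F x = (szasz_var F m x - sigma2 F x +
   f x * (poisson_excess (m%:R * x) / m%:R)) - f x * (poisson_excess (m%:R * x) / m%:R).
  by rewrite addrK.
rewrite sV mulrBr (le_trans (ler_normB _ _))//.
apply: (@le_trans _ _ (4 * M * x + Mf * (2 * x + 3))); last first.
  have : 0 <= Mf * x by rewrite mulr_ge0.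
  have : 0 <= M by []; lra.
apply: lerD.
  rewrite normrM ger0_norm ?(ltW s0)// (le_trans (ler_wpM2l (ltW s0) H))//.
  by rewrite mulrCA ler_wpM2l ?mulr_ge0// e ler_pdivrMr// ler_peMr.
rewrite mulrCA normrM; apply: ler_pM => //.
rewrite e ger0_norm ?divr_ge0 ?poisson_excess_ge0 ?(ltW s0)//.
by rewrite ler_pdivrMr// [leRHS]mulrC.
Qed.

End SzaszAsymptotics.

(** * Moments of the empirical distribution function *)

Section PoissonMeanMeasurable.
Context {R : realType}.

Lemma measurable_pmean d (T : measurableType d) (D : set T) (l : T -> R)
    (Z : nat -> T -> R) : measurable_fun D l ->
  (forall k, measurable_fun D (Z k)) ->
  (forall t, D t -> psummable (l t) (Z^~ t)) ->
  measurable_fun D (fun t => pmean (l t) (Z^~ t)).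
Proof.
move=> ml mZ sZ.
apply: (@measurable_fun_cvg _ _ _ _ (fun n t => series (fun k => Z k t * poisson_weight (l t) k) n)).
  move=> n; apply: measurable_sum => k; apply: measurable_funM => //.
  apply: measurable_funM; first by do 2 apply: measurableT_comp => //.
  by apply: measurable_funM; [exact: measurable_funX|exact: measurable_cst].
by move=> t Dt; apply: pmean_cvg; exact: sZ.
Qed.

Context d (T : measurableType d) (P : probability T R).

Lemma integrable_bounded (Z : T -> R) c : measurable_fun setT Z ->
  (forall w, `|Z w| <= c) -> P.-integrable setT (EFin \o Z).
Proof.
move=> mZ Zc; apply: (@le_integrable _ _ _ _ _ _ _ (EFin \o cst c)) => //.
- exact/measurable_EFinP.
- by move=> w _; rewrite /= lee_fin (le_trans (Zc w))// ler_norm.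
- exact: finite_measure_integrable_cst.
Qed.

(** The weights are nonnegative and sum to 1, so all partial sums are dominated by the constant [c],
    which is integrable under a probability. *)
Lemma Rintegral_pmean l (Z : nat -> T -> R) c : 0 <= l ->
  (forall k, measurable_fun setT (Z k)) -> (forall k w, `|Z k w| <= c) ->
  \int[P]_w pmean l (Z^~ w) = pmean l (fun k => \int[P]_w Z k w).
Proof.
move=> l0 mZ Zc; apply/esym/cvg_lim => //.
pose f n w := series (fun k => Z k w * poisson_weight l k) n.
have mf n : measurable_fun setT (f n).
  by apply: measurable_sum => k; apply: measurable_funM.
have fc n w : `|f n w| <= c.
  have c0 : 0 <= c by exact: le_trans (Zc 0%N w).
  rewrite /f /series/= (le_trans (ler_norm_sum _ _ _))//.
  apply: (@le_trans _ _ (series (fun k => c * poisson_weight l k) n)).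
    apply: ler_sum => k _; rewrite normrM ler_pM//.
    by rewrite ger0_norm// poisson_weight_ge0.
  rewrite -[leRHS](pmean_cst l); apply: nondecreasing_cvgn_le.
    by apply: nondecreasing_series => k _ _; rewrite mulr_ge0// poisson_weight_ge0.
  exact/psummable_cvg/psummable_cst.
have iZ k : P.-integrable setT (EFin \o Z k) by exact: integrable_bounded (Zc k).
have fE : series (fun k => (\int[P]_w Z k w) * poisson_weight l k) =
          (fun n => \int[P]_w f n w).
  apply/funext; elim=> [|n IHn].
    rewrite /series/= big_nil -[LHS](mul0r (fine (P setT))) -Rintegral_cst//.
    by apply: eq_Rintegral => w _; rewrite /f /series/= big_nil.
  transitivity (\int[P]_w (f n w + Z n w * poisson_weight l n)).
    rewrite RintegralD//; last 2 first.
    - exact: integrable_bounded (fc n).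
    - exact: (integrableZr measurableT _ (iZ n)).
    by rewrite seriesSr IHn RintegralZr.
  by apply: eq_Rintegral => w _; rewrite /f seriesSr.
rewrite fE.
have [] := @dominated_convergence _ T R P setT measurableT (fun n => EFin \o f n)
  (EFin \o (fun w => pmean l (Z^~ w))) (EFin \o cst c).
- by move=> n; exact/measurable_EFinP.
- apply/measurable_EFinP; apply: measurable_pmean => // w _.
  exact: psummable_bounded (Zc^~ w).
- apply: aeW => w _ /=; apply/fine_cvgP; split; first exact: nearW.
  by apply: pmean_cvg; exact: psummable_bounded (Zc^~ w).
- exact: finite_measure_integrable_cst.
- by apply: aeW => w n _; rewrite /= lee_fin fc.
move=> iL _ H; rewrite -[X in _ --> X]fineK in H; last exact: integrable_fin_num.
by case/fine_cvgP : H.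
Qed.

End PoissonMeanMeasurable.

Lemma Rintegral_sum d (T : measurableType d) (R : realType)
    (mu : {measure set T -> \bar R}) (I : Type) (s : seq I) (g : I -> T -> R) :
  (forall i, mu.-integrable setT (EFin \o g i)) ->
  mu.-integrable setT (EFin \o (fun w => \sum_(i <- s) g i w)) /\
  \int[mu]_w (\sum_(i <- s) g i w) = \sum_(i <- s) \int[mu]_w g i w.
Proof.
move=> ig; elim: s => [|i s [IHi IHs]].
  have -> : (fun w => \sum_(i <- [::]) g i w) = cst 0.
    by apply/funext => w; rewrite big_nil.
  split; first exact: integrable0.
  by rewrite big_nil /Rintegral integral0.
have -> : (fun w => \sum_(j <- i :: s) g j w) = (fun w => g i w + \sum_(j <- s) g j w).
  by apply/funext => w; rewrite big_cons.
split; first exact: (integrableD measurableT (ig i) IHi).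
by rewrite RintegralD// IHs big_cons.
Qed.

Lemma cdf_range d (T : measurableType d) (R : realType) (P : probability T R)
    (Y : {RV P >-> R}) (F : R -> R) : (forall x, cdf Y x = (F x)%:E) ->
  forall x, 0 <= F x <= 1.
Proof.
by move=> FE x; have := cdf_ge0 Y x; have := cdf_le1 Y x; rewrite FE !lee_fin => -> ->.
Qed.

Section EmpiricalCdf.
Context d (T : measurableType d) (R : realType) (P : probability T R)
  (X : nat -> {RV P >-> R}) (F : R -> R).
Context (X_iid : iid X) (F_cdf : forall i x, cdf (X i) x = (F x)%:E).

Let below (i : nat) (s : R) (w : T) : R := (X i w <= s)%R%:R.

Let belowE i s : below i s = \1_(X i @^-1` `]-oo, s]).
Proof.
apply/funext => w; rewrite /below indicE; congr ((nat_of_bool _)%:R).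
by apply/idP/idP; rewrite in_setE/= in_itv.
Qed.

Let mX i s : measurable (X i @^-1` `]-oo, s]).
Proof. by rewrite -[X in measurable X]setTI; exact: measurable_funP. Qed.

Lemma joint_cdf i j s t :
  P (X i @^-1` `]-oo, s] `&` X j @^-1` `]-oo, t]) =
  (if i == j then F (Num.min s t) else F s * F t)%:E.
Proof.
have [->|ij] := eqVneq i j.
  rewrite -(F_cdf j) /cdf /distribution /pushforward -preimage_setI; congr (P (_ @^-1` _)).
  apply/seteqP; split => y /=; rewrite !in_itv/= le_min => /=.
    by move=> [-> ->].
  by move=> /andP[].
(* Independence is stated for families over all of [nat]; only the values at [i] and [j] matter
   here. *)
pose B k : set R := if k == i then `]-oo, s]%classic else `]-oo, t]%classic.
have mB k : measurable (B k) by rewrite /B; case: ifP.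
have := X_iid.1 [fset i; j]%fset B mB.
rewrite big_fsetU1 ?inE// big_seq_fset1.
have -> : \bigcap_(k in [set` [fset i; j]%fset]) X k @^-1` B k =
    X i @^-1` `]-oo, s] `&` X j @^-1` `]-oo, t].
  apply/seteqP; split => w /=.
    move=> H; split.
      by have := H i; rewrite /= !inE eqxx /B eqxx; apply.
    by have := H j; rewrite /= !inE eqxx orbT /B eq_sym (negbTE ij); apply.
  move=> [Hi Hj] k /=; rewrite !inE => /orP[] /eqP ->; rewrite /B ?eqxx//.
  by rewrite eq_sym (negbTE ij).
rewrite /B eqxx eq_sym (negbTE ij) => ->.
by rewrite EFinM -(F_cdf i s) -(F_cdf j t).
Qed.

Let F_range x : 0 <= F x <= 1. Proof. exact: cdf_range (F_cdf 0%N) x. Qed.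

Lemma measurable_emp_cdf n s : measurable_fun setT (emp_cdf X n s).
Proof.
apply: measurable_funM => //; apply: measurable_sum => i.
by rewrite -/(below i s) belowE; exact: measurable_indic.
Qed.

Lemma emp_cdf_range n s w : 0 <= emp_cdf X n s w <= 1.
Proof.
rewrite /emp_cdf mulr_ge0 ?invr_ge0 ?sumr_ge0//=.
case: n => [|n]; first by rewrite big_ord0 mulr0.
rewrite mulrC ler_pdivrMr ?ltr0n// mul1r.
apply: (@le_trans _ _ (\sum_(i < n.+1) 1)); last by rewrite sumr_const card_ord.
by apply: ler_sum => i _; rewrite lern1 leq_b1.
Qed.

Let RintegralI (A : set T) : measurable A -> \int[P]_w \1_A w = fine (P A).
Proof. by move=> mA; rewrite /Rintegral integral_indic// setIT. Qed.

Let iI (A : set T) : measurable A -> P.-integrable setT (EFin \o (\1_A : T -> R)).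
Proof.
move=> mA; apply: (@integrable_bounded _ _ _ _ _ 1); first exact: measurable_indic.
by move=> w; rewrite indicE normr_nat lern1 leq_b1.
Qed.

Let i_below i s : P.-integrable setT (EFin \o below i s).
Proof. by rewrite belowE; exact: iI. Qed.

Lemma mean_emp_cdf n s : (0 < n)%N -> \int[P]_w emp_cdf X n s w = F s.
Proof.
move=> n0.
have [iS ES] := @Rintegral_sum _ T R P _ (index_enum 'I_n) (fun i => below i s)
  (fun i => i_below i s).
rewrite /emp_cdf RintegralZl// ES.
rewrite (eq_bigr (fun=> F s)).
  by rewrite sumr_const card_ord -[F s *+ _]mulr_natl mulKf// pnatr_eq0 -lt0n.
move=> i _; transitivity (\int[P]_w (\1_(X i @^-1` `]-oo, s]) w)).
  by apply: eq_Rintegral => w _; rewrite belowE.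
by rewrite RintegralI// -[P _]/(cdf (X i) s) F_cdf.
Qed.

(** Among the n^2 index pairs, the n diagonal ones contribute [F (Num.min s t)] and the n (n - 1)
    others, by independence, [F s * F t]. *)
Lemma mean_emp_cdfM n s t : (0 < n)%N ->
  \int[P]_w (emp_cdf X n s w * emp_cdf X n t w) =
  n%:R^-1 * (F (Num.min s t) - F s * F t) + F s * F t.
Proof.
move=> n0; have n1 : n%:R != 0 :> R by rewrite pnatr_eq0 -lt0n.
pose g (ij : 'I_n * 'I_n) w := below ij.1 s w * below ij.2 t w.
have gE ij : g ij = \1_(X ij.1 @^-1` `]-oo, s] `&` X ij.2 @^-1` `]-oo, t]).
  by apply/funext => w; rewrite /g !belowE indicI.
have ig ij : P.-integrable setT (EFin \o g ij).
  by rewrite gE; apply: iI; exact: measurableI.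
have [iS ES] := Rintegral_sum (index_enum ('I_n * 'I_n)%type) ig.
have -> : (fun w => emp_cdf X n s w * emp_cdf X n t w) =
          (fun w => n%:R^-1 ^+ 2 * \sum_(ij <- index_enum ('I_n * 'I_n)%type) g ij w).
  apply/funext => w; rewrite /emp_cdf mulrACA -expr2; congr (_ * _).
  by rewrite big_distrlr/= pair_big.
rewrite RintegralZl// ES.
rewrite (eq_bigr (fun ij : 'I_n * 'I_n =>
    if ij.1 == ij.2 :> nat then F (Num.min s t) else F s * F t)); last first.
  move=> ij _; transitivity (\int[P]_w (\1_(X ij.1 @^-1` `]-oo, s] `&` X ij.2 @^-1` `]-oo, t]) w)).
    by apply: eq_Rintegral => w _; rewrite gE.
  by rewrite RintegralI ?joint_cdf//; exact: measurableI.
rewrite -(pair_big xpredT xpredT (fun i j : 'I_n => if i == j :> nat then F (Num.min s t) else F s * F t))/=.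
rewrite (eq_bigr (fun=> F (Num.min s t) + F s * F t *+ n.-1)); last first.
  move=> i _; rewrite (bigD1 i)//= eqxx; congr (_ + _).
  rewrite (eq_bigr (fun=> F s * F t)).
    by rewrite sumr_const cardC1 card_ord.
  by move=> j ji; rewrite eq_sym val_eqE (negbTE ji).
rewrite sumr_const card_ord -[X in _ * X]mulr_natl -[F s * F t *+ _]mulr_natl.
have -> : n.-1%:R = n%:R - 1 :> R by rewrite -subn1 natrB.
by move: (F s * F t) (F (Num.min s t)) => u v; field.
Qed.

Let i_emp n s : P.-integrable setT (EFin \o emp_cdf X n s).
Proof.
apply: (@integrable_bounded _ _ _ _ _ 1); first exact: measurable_emp_cdf.
by move=> w; have /andP[e0 e1] := emp_cdf_range n s w; rewrite ger0_norm.
Qed.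

Lemma mean_emp_cdfM_centered n s t (c : R) : (0 < n)%N ->
  \int[P]_w ((emp_cdf X n s w - c) * (emp_cdf X n t w - c)) =
  n%:R^-1 * (F (Num.min s t) - F s * F t) + (F s - c) * (F t - c).
Proof.
move=> n0.
have iM : P.-integrable setT (EFin \o (fun w => emp_cdf X n s w * emp_cdf X n t w)).
  apply: (@integrable_bounded _ _ _ _ _ 1).
    by apply: measurable_funM; exact: measurable_emp_cdf.
  move=> w; have /andP[e0 e1] := emp_cdf_range n s w.
  have /andP[e0' e1'] := emp_cdf_range n t w.
  by rewrite normrM !ger0_norm// mulr_ile1.
have iZ u := integrableZl measurableT c (i_emp n u).
have ic := @finite_measure_integrable_cst _ T R P setT (c ^+ 2) measurableT.
transitivity (\int[P]_w (((emp_cdf X n s w * emp_cdf X n t w - c * emp_cdf X n s w)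
   - c * emp_cdf X n t w) + c ^+ 2)).
  by apply: eq_Rintegral => w _; ring.
pose EE w := emp_cdf X n s w * emp_cdf X n t w.
pose cE u w := c * emp_cdf X n u w.
have icE u : P.-integrable setT (EFin \o cE u) by exact: iZ.
have i1 : P.-integrable setT (EFin \o (fun w => EE w - cE s w)).
  exact: (integrableB measurableT iM (icE s)).
have i2 : P.-integrable setT (EFin \o (fun w => EE w - cE s w - cE t w)).
  exact: (integrableB measurableT i1 (icE t)).
rewrite (RintegralD measurableT i2 ic) (RintegralB measurableT i1 (icE t)).
rewrite (RintegralB measurableT iM (icE s)).
have cEE u : \int[P]_w cE u w = c * F u.
  by rewrite (RintegralZl c measurableT (i_emp n u)) mean_emp_cdf.
rewrite !cEE mean_emp_cdfM//.
have -> : \int[P]_w (cst (c ^+ 2) w) = c ^+ 2.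
  rewrite Rintegral_cst//; transitivity (c ^+ 2 * fine (1%:E : \bar R)); last exact: mulr1.
  by congr (_ * fine _); exact: probability_setT.
ring.
Qed.

(** The square is written as a Poisson mean of [D w * Y k w], and [D w] is expanded afterwards, so
    that the expectation crosses one series at a time. The covariances between grid points then
    average to the variance term and the products of mean errors to the squared bias. *)
Lemma mean_szasz_sqr_error m n x : (0 < m)%N -> (0 < n)%N -> 0 <= x ->
  \int[P]_w (szasz_estimator X m n x w - F x) ^+ 2 =
  n%:R^-1 * szasz_var F m x + szasz_bias F m x ^+ 2.
Proof.
move=> m0 n0 x0; pose l := m%:R * x; pose c := F x.
have l0 : 0 <= l by rewrite mulr_ge0.
pose Y k w := emp_cdf X n (k%:R / m%:R) w - c.
have Y1 k w : `|Y k w| <= 1.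
  have /andP[e0 e1] := emp_cdf_range n (k%:R / m%:R) w.
  have /andP[c0 c1] := F_range x.
  by rewrite ler_norml /Y /c; apply/andP; split; lra.
have mY k : measurable_fun setT (Y k).
  by apply: measurable_funB; [exact: measurable_emp_cdf|exact: measurable_cst].
have sY w : psummable l (Y^~ w) by exact: psummable_bounded (Y1^~ w).
pose D w := pmean l (Y^~ w).
have mD : measurable_fun setT D by apply: measurable_pmean => // w _; exact: sY.
have D1 w : `|D w| <= 1.
  rewrite -[leRHS](pmean_cst l); apply: ler_norm_pmean => //; exact: psummable_cst.
have DE w : szasz_estimator X m n x w - F x = D w.
  rewrite /D /Y pmeanB ?pmean_cst//; last exact: psummable_cst.
  apply: (@psummable_bounded _ _ 1) => k.
  by have /andP[e0 e1] := emp_cdf_range n (k%:R / m%:R) w; rewrite ger0_norm.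
transitivity (\int[P]_w pmean l (fun k => D w * Y k w)).
  by apply: eq_Rintegral => w _; rewrite DE pmeanZ.
rewrite (@Rintegral_pmean _ _ _ _ l (fun k w => D w * Y k w) 1)//; last 2 first.
- by move=> k; exact: measurable_funM.
- by move=> k w; rewrite normrM mulr_ile1.
have inner k : \int[P]_w (D w * Y k w) = pmean l (fun j => \int[P]_w (Y k w * Y j w)).
  rewrite -(@Rintegral_pmean _ _ _ _ l (fun j w => Y k w * Y j w) 1)//; last 2 first.
  - by move=> j; exact: measurable_funM.
  - by move=> j w; rewrite normrM mulr_ile1.
  by apply: eq_Rintegral => w _; rewrite mulrC -pmeanZ.
pose S := szasz F m x; pose p k := k%:R / m%:R : R.
have Fb (s : R) : `|F s| <= 1 by have /andP[? ?] := F_range s; rewrite ger0_norm.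
have sF (s : nat -> R) : psummable l (fun k => F (s k)).
  by apply: (@psummable_bounded _ _ 1) => k.
pose G k := pmean l (fun j => F ((minn k j)%:R / m%:R)).
have sG : psummable l G.
  apply: (@psummable_bounded _ _ 1) => k; rewrite -[leRHS](pmean_cst l).
  by apply: ler_norm_pmean => //; exact: psummable_cst.
have minE k j : Num.min (p k) (p j) = (minn k j)%:R / m%:R.
  rewrite /p -minr_pMl ?invr_ge0//; congr (_ / _).
  by rewrite minEle ler_nat /minn ltnNge leq_eqVlt; case: ltngtP => // ->.
have outer k : pmean l (fun j => \int[P]_w (Y k w * Y j w)) =
    n%:R^-1 * G k + (((1 - n%:R^-1) * S - c) * F (p k) + (c ^+ 2 - c * S)).
  transitivity (pmean l (fun j => n%:R^-1 * F ((minn k j)%:R / m%:R) +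
      ((F (p k) - n%:R^-1 * F (p k) - c) * F (p j) + (c ^+ 2 - c * F (p k))))).
    by apply: eq_pmean => j; rewrite mean_emp_cdfM_centered// minE -/(p k) -/(p j); ring.
  have s1 : psummable l (fun j => F ((minn k j)%:R / m%:R)).
    exact: (sF (fun j => (minn k j)%:R / m%:R)).
  have s2 := sF p.
  have s3 := @psummable_cst _ l (c ^+ 2 - c * F (p k)).
  have s4 := @psummableZ _ l (F (p k) - n%:R^-1 * F (p k) - c) _ s2.
  rewrite pmeanD; [|exact: psummableZ|exact: psummableD].
  rewrite pmeanD// (pmeanZ _ s1) (pmeanZ _ s2) pmean_cst -/(G k) -[pmean l _]/S.
  ring.
rewrite (eq_pmean _ inner) (eq_pmean _ outer).
have s2 := sF p.
have s3 := @psummable_cst _ l (c ^+ 2 - c * S).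
have s4 := @psummableZ _ l ((1 - n%:R^-1) * S - c) _ s2.
rewrite pmeanD; [|exact: psummableZ|exact: psummableD].
rewrite pmeanD// (pmeanZ _ sG) (pmeanZ _ s2) pmean_cst -[pmean l G]/(szasz_min F m x).
rewrite -[pmean l _]/S /szasz_var /szasz_bias -/S -/c; ring.
Qed.

End EmpiricalCdf.

(** * Integration against the weight *)

Section WeightedIntegral.
Context {R : realType} (f : R -> R) (a : R).
Context (a_gt0 : 0 < a) (f_ge0 : forall x : R, 0 <= x -> 0 <= f x).
Local Notation mu := (@lebesgue_measure R).
Local Notation D := (`[0, +oo[%classic : set R).
Context (f_int : mu.-integrable D (EFin \o f)).

Let inD x : D x -> 0 <= x. Proof. by rewrite /= in_itv/= andbT. Qed.

Let mf : measurable_fun D f.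
Proof. by have := measurable_int mu f_int; move=> /measurable_EFinP. Qed.

Definition wint (g : R -> R) : R :=
  \int[mu]_(x in D) (g x * expR (- (a * x)) * f x).

(** This is the square of 1 + x <= (1 + 2 / a) (1 + a x / 2) <= (1 + 2 / a) e^(a x / 2). *)
Lemma exp_decay_le (x : R) : 0 <= x -> (1 + x) ^+ 2 * expR (- (a * x)) <= (1 + 2 / a) ^+ 2.
Proof.
move=> x0; have -> : expR (- (a * x)) = expR (- (a * x / 2)) ^+ 2.
  by rewrite expr2 -expRD; congr expR; field.
have x1 : 0 <= 1 + x by rewrite addr_ge0.
have a1 : 0 <= 1 + 2 / a by rewrite addr_ge0// divr_ge0// ltW.
rewrite -exprMn ler_pXn2r ?nnegrE ?mulr_ge0 ?expR_ge0//.
rewrite expRN ler_pdivrMr ?expR_gt0//.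
apply: (@le_trans _ _ ((1 + 2 / a) * (1 + a * x / 2))); last first.
  by rewrite ler_wpM2l// expR_ge1Dx.
have -> : (1 + 2 / a) * (1 + a * x / 2) = 1 + x + (2 / a + a * x / 2).
  by field; rewrite gt_eqF.
by rewrite lerDl addr_ge0 ?divr_ge0 ?mulr_ge0// ltW.
Qed.

Let measurable_weight (g : R -> R) : measurable_fun D g ->
  measurable_fun D (fun x => g x * expR (- (a * x)) * f x).
Proof.
move=> mg; apply: measurable_funM => //; apply: measurable_funM => //.
by do 2 apply: measurableT_comp => //; exact: measurable_funM.
Qed.

Let weight_le (K g x : R) : 0 <= x -> `|g| <= K * (1 + x) ^+ 2 ->
  `|g * expR (- (a * x)) * f x| <= K * (1 + 2 / a) ^+ 2 * f x.
Proof.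
move=> x0 gK; have fx := f_ge0 x0.
have K0 : 0 <= K.
  rewrite -(pmulr_lge0 _ (_ : 0 < (1 + x) ^+ 2)) ?exprn_gt0 ?ltr_pwDl//.
  exact: le_trans gK.
rewrite normrM (ger0_norm fx) ler_wpM2r// normrM [X in _ * X]ger0_norm ?expR_ge0//.
apply: (le_trans (ler_wpM2r (expR_ge0 _) gK)).
by rewrite -mulrA ler_wpM2l// exp_decay_le.
Qed.

Let weight_dom (K : R) : mu.-integrable D (EFin \o (fun x => K * f x)).
Proof. exact: (integrableZl _ _ f_int). Qed.

Lemma integrable_weight (g : R -> R) (K : R) : measurable_fun D g ->
  (forall x, 0 <= x -> `|g x| <= K * (1 + x) ^+ 2) ->
  mu.-integrable D (EFin \o (fun x => g x * expR (- (a * x)) * f x)).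
Proof.
move=> mg gK; apply: le_integrable (weight_dom (K * (1 + 2 / a) ^+ 2)) => //.
  by apply/measurable_EFinP; exact: (measurable_weight mg).
move=> x /inD x0; rewrite /= lee_fin (le_trans (weight_le x0 (gK x x0)))//.
exact: ler_norm.
Qed.

Lemma cvg_wint (g_ : nat -> R -> R) (g : R -> R) (K : R) :
  (forall n, measurable_fun D (g_ n)) ->
  (forall n x, (0 < n)%N -> 0 <= x -> `|g_ n x| <= K * (1 + x) ^+ 2) ->
  (forall x, 0 <= x -> g_ n x @[n --> \oo] --> g x) ->
  wint (g_ n) @[n --> \oo] --> wint g.
Proof.
(* The bound is available for positive indices only, hence the shift by one. *)
move=> mg_ gK gg; rewrite -cvg_shiftS.
have mg : measurable_fun D g.
  by apply: measurable_fun_cvg mg_ _ => x /inD; exact: gg.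
have [] := @dominated_convergence _ _ R mu D (measurable_itv _)
  (fun n => EFin \o (fun x => g_ n.+1 x * expR (- (a * x)) * f x))
  (EFin \o (fun x => g x * expR (- (a * x)) * f x))
  (EFin \o (fun x => K * (1 + 2 / a) ^+ 2 * f x)).
- by move=> n; apply/measurable_EFinP; exact: (measurable_weight (mg_ n.+1)).
- by apply/measurable_EFinP; exact: (measurable_weight mg).
- apply: aeW => x /inD x0; apply/fine_cvgP; split; first exact: nearW.
  apply: cvgM; last exact: cvg_cst.
  apply: cvgM; last exact: cvg_cst.
  by rewrite (cvg_shiftS (g_^~ x)); exact: gg.
- exact: weight_dom.
- by apply: aeW => x n /inD x0; rewrite /= lee_fin weight_le// gK.
move=> iL _ H; rewrite -[X in _ --> X]fineK in H; last exact: integrable_fin_num.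
by case/fine_cvgP : H.
Qed.

Lemma wint_linear (g h : R -> R) (c1 c2 K1 K2 : R) :
  measurable_fun D g -> measurable_fun D h ->
  (forall x, 0 <= x -> `|g x| <= K1 * (1 + x) ^+ 2) ->
  (forall x, 0 <= x -> `|h x| <= K2 * (1 + x) ^+ 2) ->
  wint (fun x => c1 * g x + c2 * h x) = c1 * wint g + c2 * wint h.
Proof.
move=> mg mh gK hK.
have ig := integrable_weight mg gK; have ih := integrable_weight mh hK.
rewrite /wint -RintegralZl// -RintegralZl// -RintegralD//; last 2 first.
- exact: (integrableZl _ _ ig).
- exact: (integrableZl _ _ ih).
by apply: eq_Rintegral => x _; ring.
Qed.

End WeightedIntegral.

(** * Sign and integrability of the density *)

Section Density.
Context d (T : measurableType d) (R : realType) (P : probability T R)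
  (Y : {RV P >-> R}) (F f : R -> R).
Local Notation mu := (@lebesgue_measure R).
Local Notation D := (`[0, +oo[%classic : set R).

(** A negative derivative at [x] would make the nondecreasing [F] smaller just to the right of [x].
    This gives the sign at every point, where a density alone gives it almost everywhere. *)
Lemma density_nonneg : (forall x, cdf Y x = (F x)%:E) -> derivative_ge0 F f ->
  forall x, 0 <= x -> 0 <= f x.
Proof.
move=> FE dF x x0; rewrite leNgt; apply/negP => fx.
have e0 : 0 < - f x / 2 by rewrite divr_gt0// oppr_gt0.
have [r r0 /(_ (x + r / 2))] := derivative_ge0_approx dF x0 e0.
have r2 : 0 < r / 2 by rewrite divr_gt0.
rewrite addrAC subrr add0r (gtr0_norm r2) => /(_ (addr_ge0 x0 (ltW r2))).
have -> : r / 2 < r by lra.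
move=> /(_ isT); rewrite ler_norml => /andP[_].
have : F x <= F (x + r / 2).
  by rewrite -lee_fin -!FE; apply: (cdf_nondecreasing Y); rewrite lerDl ltW.
have : 0 < - f x * (r / 2) by rewrite mulr_gt0// oppr_gt0.
lra.
Qed.

Lemma density_integrable : {within D, continuous f} ->
  (forall x, 0 <= x -> 0 <= f x) -> density_ge0 Y f ->
  mu.-integrable D (EFin \o f).
Proof.
move=> cf f0 df; apply/integrableP; split.
  by apply/measurable_EFinP; exact: subspace_continuous_measurable_fun.
have := df setT measurableT; rewrite setTI => H.
rewrite [X in (X < _)%E](_ : _ = distribution P Y setT); last first.
  rewrite H; apply: eq_integral => x; rewrite inE/= in_itv/= andbT => x0.
  by rewrite ger0_norm// f0.
by rewrite (le_lt_trans (probability_le1 _ _))// ltry.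
Qed.

End Density.

(** * The mean integrated squared error as a weighted integral *)

Section SzaszMISE.
Context d (T : measurableType d) (R : realType) (P : probability T R)
  (X : nat -> {RV P >-> R}) (F f : R -> R) (a : R).
Context (X_iid : iid X) (F_cdf : forall i x, cdf (X i) x = (F x)%:E).
Context (F_continuous : continuous F) (f_ge0 : forall x : R, 0 <= x -> 0 <= f x).
Local Notation mu := (@lebesgue_measure R).
Local Notation D := (`[0, +oo[%classic : set R).
Context (f_int : mu.-integrable D (EFin \o f)) (a_gt0 : 0 < a).

Let F_range x : 0 <= F x <= 1. Proof. exact: cdf_range (F_cdf 0%N) x. Qed.

Let mF : measurable_fun setT F.
Proof. exact: continuous_measurable_fun. Qed.

Let mscale (m : nat) : measurable_fun setT (fun x : R => m%:R * x).
Proof. exact: measurable_funM. Qed.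

Lemma measurable_szasz m : measurable_fun setT (szasz F m).
Proof.
apply: (@measurable_pmean R _ _ setT (fun x : R => m%:R * x)
  (fun k _ => F (k%:R / m%:R))) => //.
by move=> x _; apply: (@psummable_bounded _ _ 1) => k;
  have /andP[F0 F1] := F_range (k%:R / m%:R); rewrite ger0_norm.
Qed.

Let szasz_range m x : 0 <= x -> 0 <= szasz F m x <= 1.
Proof.
move=> x0; have l0 : 0 <= m%:R * x by rewrite mulr_ge0.
have s : psummable (m%:R * x) (fun k => F (k%:R / m%:R)).
  by apply: (@psummable_bounded _ _ 1) => k;
    have /andP[F0 F1] := F_range (k%:R / m%:R); rewrite ger0_norm.
apply/andP; split.
  by apply: pmean_ge0 => // k; have /andP[] := F_range (k%:R / m%:R).
rewrite -[leRHS](pmean_cst (m%:R * x)); apply: le_pmean => //.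
  exact: psummable_cst.
by move=> k; have /andP[] := F_range (k%:R / m%:R).
Qed.

Lemma measurable_szasz_var m : measurable_fun D (szasz_var F m).
Proof.
apply: measurable_funB; last first.
  by apply: measurable_funX; apply: measurable_funTS; exact: measurable_szasz.
have Fb k j : `|F ((minn k j)%:R / m%:R)| <= 1.
  by have /andP[F0 F1] := F_range ((minn k j)%:R / m%:R); rewrite ger0_norm.
apply: (@measurable_pmean R _ _ D (fun x : R => m%:R * x)
  (fun k x => pmean (m%:R * x) (fun j => F ((minn k j)%:R / m%:R)))).
- by apply: measurable_funTS; exact: mscale.
- move=> k; apply: (@measurable_pmean R _ _ D (fun x : R => m%:R * x)
    (fun j _ => F ((minn k j)%:R / m%:R))) => //.
  + by apply: measurable_funTS; exact: mscale.
  + by move=> x _; exact: psummable_bounded (Fb k).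
move=> x; rewrite /= in_itv/= andbT => x0.
apply: (@psummable_bounded _ _ 1) => k; rewrite -[leRHS](pmean_cst (m%:R * x)).
by apply: ler_norm_pmean; rewrite ?mulr_ge0//; exact: psummable_cst.
Qed.

Lemma measurable_szasz_bias m : measurable_fun D (szasz_bias F m).
Proof.
by apply: measurable_funB; apply: measurable_funTS => //; exact: measurable_szasz.
Qed.

(** Crude bounds, valid for every [m] including 0: they serve integrability at fixed [m], not the
    limits. *)
Lemma szasz_bias_le1 m x : 0 <= x -> `|szasz_bias F m x| <= 1.
Proof.
move=> x0; have /andP[s0 s1] := szasz_range m x0; have /andP[F0 F1] := F_range x.
by rewrite ler_norml /szasz_bias; apply/andP; split; lra.
Qed.

Lemma szasz_var_le1 m x : 0 <= x -> `|szasz_var F m x| <= 2.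
Proof.
move=> x0; have /andP[s0 s1] := szasz_range m x0.
have l0 : 0 <= m%:R * x by rewrite mulr_ge0.
have Fb k j : `|F ((minn k j)%:R / m%:R)| <= 1.
  by have /andP[F0 F1] := F_range ((minn k j)%:R / m%:R); rewrite ger0_norm.
rewrite (le_trans (ler_normB _ _))// -[leRHS]/(1 + 1) lerD//; last first.
  by rewrite ger0_norm ?sqr_ge0// expr2 mulr_ile1.
rewrite -[leRHS](pmean_cst (m%:R * x)); apply: ler_norm_pmean => //.
  exact: psummable_cst.
move=> k; rewrite -[leRHS](pmean_cst (m%:R * x)); apply: ler_norm_pmean => //.
exact: psummable_cst.
Qed.

Let emp_summable n (m : nat) l w : psummable l (fun k => emp_cdf X n (k%:R / m%:R) w).
Proof.
apply: (@psummable_bounded _ _ 1) => k.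
by have /andP[e0 e1] := emp_cdf_range X n (k%:R / m%:R) w; rewrite ger0_norm.
Qed.

(** Exchanging the two integrals requires joint measurability; each term is a function of [w] times
    a function of [x]. *)
Lemma measurable_szasz_estimator m n :
  measurable_fun setT (fun z : T * R => szasz_estimator X m n z.2 z.1).
Proof.
apply: (@measurable_pmean R _ _ _ (fun z : T * R => m%:R * z.2)
  (fun k z => emp_cdf X n (k%:R / m%:R) z.1)).
- by apply: measurable_funM => //; exact: measurable_snd.
- move=> k; apply: (measurableT_comp (measurable_emp_cdf X n _)).
  exact: measurable_fst.
- by move=> z _; exact: emp_summable.
Qed.

Lemma szasz_estimator_range m n x w : 0 <= x -> 0 <= szasz_estimator X m n x w <= 1.
Proof.
move=> x0; have l0 : 0 <= m%:R * x by rewrite mulr_ge0.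
apply/andP; split.
  apply: (@pmean_ge0 _ (m%:R * x) (fun k => emp_cdf X n (k%:R / m%:R) w)) => //.
  by move=> k; have /andP[] := emp_cdf_range X n (k%:R / m%:R) w.
rewrite -[leRHS](pmean_cst (m%:R * x)).
apply: (@le_pmean _ (m%:R * x) (fun k => emp_cdf X n (k%:R / m%:R) w)) => //.
  exact: psummable_cst.
by move=> k; have /andP[] := emp_cdf_range X n (k%:R / m%:R) w.
Qed.

Let sqr_error m n (z : T * R) : R := (szasz_estimator X m n z.2 z.1 - F z.2) ^+ 2.

Let measurable_sqr_error m n : measurable_fun setT (sqr_error m n).
Proof.
apply: measurable_funX; apply: measurable_funB; first exact: measurable_szasz_estimator.
by apply: (measurableT_comp mF); exact: measurable_snd.
Qed.

Let sqr_error_le1 m n w x : 0 <= x -> `|sqr_error m n (w, x)| <= 1.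
Proof.
move=> x0; rewrite ger0_norm ?sqr_ge0// /sqr_error /=.
have /andP[s0 s1] := szasz_estimator_range m n w x0; have /andP[F0 F1] := F_range x.
by rewrite -real_normK ?num_real// expr2 mulr_ile1// ler_norml; apply/andP; split; lra.
Qed.

Let le1X (u x : R) : 0 <= x -> `|u| <= 1 -> `|u| <= 1 * (1 + x) ^+ 2.
Proof.
move=> x0 u1; rewrite mul1r (le_trans u1)// -[leLHS](expr1n _ 2).
by rewrite ler_pXn2r ?nnegrE ?addr_ge0// lerDl.
Qed.

(** Values of [f] at negative reals are arbitrary; cutting them off makes the integrand nonnegative
    on the whole product, as Tonelli's theorem asks. *)
Let f0 : R -> R := f \_ D.

Let f0_ge0 x : 0 <= f0 x.
Proof.
rewrite /f0 patchE; case: ifPn => // /set_mem; rewrite /= in_itv/= andbT.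
exact: f_ge0.
Qed.

Let mf0 : measurable_fun setT f0.
Proof.
have mfD : measurable_fun D f.
  by have := measurable_int mu f_int; move=> /measurable_EFinP.
have mD : measurable D by exact: measurable_itv.
exact/(measurable_restrictT f mD).
Qed.

Let integrand m n (z : T * R) : \bar R :=
  (sqr_error m n z * expR (- (a * z.2)) * f0 z.2)%:E.

Let measurable_integrand m n : measurable_fun setT (integrand m n).
Proof.
apply/measurable_EFinP; apply: measurable_funM.
  apply: measurable_funM => //.
  do 2 apply: measurableT_comp => //.
  by apply: measurable_funM => //; exact: measurable_snd.
by apply: (measurableT_comp mf0); exact: measurable_snd.
Qed.

(** The inner integral is a real number, so finiteness comes before it can be read as an extended
    integral and exchanged with the expectation by Tonelli's theorem. *)
Lemma szasz_MISE_wint m n : (0 < m)%N -> (0 < n)%N ->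
  szasz_MISE X F f a m n =
  (n%:R^-1 * wint f a (szasz_var F m) + wint f a (fun x => szasz_bias F m x ^+ 2))%:E.
Proof.
move=> m0 n0; rewrite /szasz_MISE unlock.
transitivity (\int[P]_w \int[mu]_x integrand m n (w, x))%E.
  apply: eq_integral => w _.
  have mw : measurable_fun D (fun x => sqr_error m n (w, x)).
    apply: measurable_funTS; apply: (measurableT_comp (measurable_sqr_error m n)).
    exact: measurable_pair1.
  have iw := integrable_weight a_gt0 f_ge0 f_int mw
    (fun x x0 => le1X x0 (sqr_error_le1 m n w x0)).
  rewrite /Rintegral fineK; last exact: integrable_fin_num iw.
  rewrite integral_mkcond; apply: eq_integral => x _.
  rewrite /integrand /f0 !patchE; case: ifPn => // _.
  by rewrite mulr0.
rewrite (@fubini_tonelli _ _ T (measurableTypeR R) R P mu)//; last 2 first.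
- exact: measurable_integrand.
- move=> z; rewrite lee_fin mulr_ge0// mulr_ge0 ?expR_ge0//.
  exact: sqr_ge0.
have msv := measurable_szasz_var m; have msb := measurable_szasz_bias m.
have bv x : 0 <= x -> `|szasz_var F m x| <= 2 * (1 + x) ^+ 2.
  move=> x0; rewrite (le_trans (szasz_var_le1 m x0))// ler_peMr//.
  by rewrite -[leLHS](expr1n _ 2) ler_pXn2r ?nnegrE ?addr_ge0// lerDl.
have bb x : 0 <= x -> `|szasz_bias F m x ^+ 2| <= 1 * (1 + x) ^+ 2.
  move=> x0; apply: le1X => //; rewrite normrX expr2.
  by rewrite mulr_ile1// szasz_bias_le1.
have msb2 : measurable_fun D (fun x => szasz_bias F m x ^+ 2) by exact: measurable_funX.
have := @wint_linear R f a a_gt0 f_ge0 f_int _ _ n%:R^-1 1 2 1 msv msb2 bv bb.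
rewrite mul1r => <-.
rewrite /wint /Rintegral fineK; last first.
  apply: integrable_fin_num => //.
  apply: (integrable_weight a_gt0 f_ge0 f_int (K := n%:R^-1 * 2 + 1)).
    by apply: measurable_funD; exact: measurable_funM.
  move=> x x0; rewrite (le_trans (ler_normD _ _))// mulrDl lerD//.
    by rewrite normrM ger0_norm ?invr_ge0// -mulrA ler_wpM2l ?invr_ge0// bv.
  by rewrite mul1r bb.
rewrite [RHS]integral_mkcond; apply: eq_integral => x _.
rewrite patchE; case: ifPn => xD; last first.
  rewrite (eq_integral (cst 0%E)) ?integral0// => w _.
  by rewrite /integrand /f0 patchE/= (negbTE xD) mulr0.
have x0 : 0 <= x by move: xD => /set_mem; rewrite /= in_itv/= andbT.
have iS : P.-integrable setT (EFin \o (fun w => sqr_error m n (w, x))).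
  apply: (@integrable_bounded _ _ _ _ _ 1); last by move=> w; exact: sqr_error_le1.
  apply: (measurableT_comp (measurable_sqr_error m n)).
  exact: measurable_pair2.
transitivity (\int[P]_w ((sqr_error m n (w, x))%:E * (expR (- (a * x)) * f x)%:E))%E.
  by apply: eq_integral => w _; rewrite /integrand /f0 patchE/= xD -mulrA EFinM.
rewrite integralZr// -[in RHS]mulrA [RHS]EFinM; congr (_ * _)%E.
rewrite mul1r -(mean_szasz_sqr_error X_iid F_cdf m0 n0 x0) /Rintegral fineK//.
exact: (integrable_fin_num _ iS).
Qed.

End SzaszMISE.

(** A ratio depending on [m] alone converges along the product filter through the first projection.
    Positivity discards the indices where inverses take default values. *)
Lemma little_o_mn_fst (R : realType) (u v : nat -> nat -> R) (h : nat -> R) :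
  (forall m n, (0 < m)%N -> (0 < n)%N -> `|u m n / v m n| = `|h m|) ->
  h m @[m --> \oo] --> 0 -> little_o_mn u v.
Proof.
move=> uvh h0.
apply: (@cvg_trans _ (`|h p.1| @[p --> filter_prod \oo (\oo : set_system nat)])).
  apply: near_eq_cvg.
  exists ([set m | (0 < m)%N], [set n | (0 < n)%N]).
    by split; exists 1%N.
  by move=> [m n] /= [m0 n0]; rewrite uvh.
apply: (cvg_comp fst (fun m => `|h m|)); first exact: cvg_fst.
by rewrite -(normr0 R); exact: cvg_norm.
Qed.

Theorem theorem7 (d : measure_display) (T : measurableType d) (R : realType)
    (P : probability T R) (X : nat -> {RV P >-> R}) (F f f' : R -> R) (a : R)
    (X_iid : iid X)
    (X_ge0 : forall i w, 0 <= X i w)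
    (F_cdf : forall i x, cdf (X i) x = (F x)%:E)
    (F0 : F 0 = 0)
    (X_density : forall i, density_ge0 (X i) f)
    (F_continuous : continuous F)
    (F_derivative : derivative_ge0 F f)
    (f_derivative : derivative_ge0 f f')
    (f_continuous : {within `[0, +oo[, continuous f})
    (f'_continuous : {within `[0, +oo[, continuous f'})
    (f_bounded : bounded_ge0 f)
    (f'_bounded : bounded_ge0 f')
    (a_gt0 : 0 < a) :
  exists r1 r2 : nat -> nat -> R,
    [/\ little_o_mn r1 (fun m n => (Num.sqrt m%:R)^-1 * n%:R^-1),
        little_o_mn r2 (fun m n => m%:R ^- 2) &
        forall m n : nat, (0 < m)%N -> (0 < n)%N ->
          szasz_MISE X F f a m n =
          (n%:R^-1 * C1S F f a
           - (Num.sqrt m%:R)^-1 * n%:R^-1 * C2S f a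
           + m%:R ^- 2 * C3S f f' a
           + r1 m n + r2 m n)%:E].
Proof.
have F_range := cdf_range (F_cdf 0%N).
have f_ge0 := density_nonneg (F_cdf 0%N) F_derivative.
have f_int := density_integrable f_continuous f_ge0 (X_density 0%N).
have [M f'_le] := f'_bounded; have [Mf f_le] := f_bounded.
pose V m := wint f a (szasz_var F m).
pose B m := wint f a (fun x => szasz_bias F m x ^+ 2).
have mF : measurable_fun setT F by exact: continuous_measurable_fun.
have msV m := measurable_szasz_var F_cdf m.
have msB m := measurable_szasz_bias F_cdf F_continuous m.
have msB2 m : measurable_fun (`[0, +oo[%classic : set R) (fun x : R => szasz_bias F m x ^+ 2).
  exact: measurable_funX.
have mS : measurable_fun (`[0, +oo[%classic : set R) (sigma2 F).
  by apply: measurable_funTS; apply: measurable_funM => //; exact: measurable_funB.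
have sq1 (x : R) : 0 <= x -> 1 <= (1 + x) ^+ 2.
  by move=> x0; rewrite -[leLHS](expr1n _ 2) ler_pXn2r ?nnegrE ?addr_ge0// lerDl.
have bV m x : 0 <= x -> `|szasz_var F m x| <= 2 * (1 + x) ^+ 2.
  by move=> x0; rewrite (le_trans (szasz_var_le1 F_cdf m x0))// ler_peMr// sq1.
have bB m x : 0 <= x -> `|szasz_bias F m x ^+ 2| <= 1 * (1 + x) ^+ 2.
  move=> x0; rewrite mul1r (le_trans _ (sq1 x x0))// normrX expr2.
  by rewrite mulr_ile1// (szasz_bias_le1 F_cdf).
have bS2 x : 0 <= x -> `|sigma2 F x| <= 1 * (1 + x) ^+ 2.
  move=> x0; rewrite mul1r (le_trans _ (sq1 x x0))// /sigma2.
  have /andP[F_0 F_1] := F_range x; have F1' : 0 <= 1 - F x by rewrite subr_ge0.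
  by rewrite ger0_norm ?mulr_ge0// mulr_ile1// gerBl.
(* This is the ratio of the first remainder to m^(-1/2) n^(-1), from which [n] has cancelled.
   Dominated convergence is applied with the opposite sign, so that the limit is [VS f] itself. *)
have cvgV : Num.sqrt m%:R * (V m - C1S F f a) + C2S f a @[m --> \oo] --> 0.
  have := @cvg_wint R f a a_gt0 f_ge0 f_int
    (fun m x => Num.sqrt m%:R * sigma2 F x + - Num.sqrt m%:R * szasz_var F m x)
    (VS f) (4 * M + 3 * Mf) _ _ _.
  move=> H; have {}H : wint f a (fun x => Num.sqrt m%:R * sigma2 F x +
      - Num.sqrt m%:R * szasz_var F m x) @[m --> \oo] --> C2S f a.
    apply: H.
    - by move=> m; apply: measurable_funD; apply: measurable_funM.
    - move=> m x m0 x0.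
      have -> : Num.sqrt m%:R * sigma2 F x + - Num.sqrt m%:R * szasz_var F m x =
        - (Num.sqrt m%:R * (szasz_var F m x - sigma2 F x)) by ring.
      rewrite normrN (le_trans (szasz_var_le F_derivative f_derivative f'_le F_range m0 x0 (f_le x x0)))//.
      have M0 : 0 <= M := le_trans (normr_ge0 _) (f'_le 0 (lexx 0)).
      have Mf0 : 0 <= Mf := le_trans (normr_ge0 _) (f_le 0 (lexx 0)).
      apply: ler_wpM2l; first by rewrite addr_ge0// mulr_ge0.
      by rewrite expr2 ler_peMr ?addr_ge0// lerDl.
    - move=> x x0; rewrite -[VS f x]opprK.
      apply: (@cvg_trans _ (- (Num.sqrt m%:R * (szasz_var F m x - sigma2 F x)) @[m --> \oo])).
        by apply: near_eq_cvg; apply: nearW => m; ring.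
      by apply: cvgN; exact: (cvg_szasz_var F_derivative f_derivative f'_le F_range x0).
  rewrite -(subrr (C2S f a)) [C2S f a - _]addrC.
  apply: cvgD; last exact: cvg_cst.
  move/cvgN : H; apply: cvg_trans; apply: near_eq_cvg; apply: nearW => m.
  transitivity (- wint f a (fun x => Num.sqrt m%:R * sigma2 F x +
      - Num.sqrt m%:R * szasz_var F m x)) => //.
  rewrite (@wint_linear R f a a_gt0 f_ge0 f_int _ _ _ _ 1 2 mS (msV m) bS2 (bV m)).
  by rewrite /V -[C1S F f a]/(wint f a (sigma2 F)); ring.
(* This is the ratio of the second remainder to m^(-2). The null second term of the integrand only
   gives it the shape that [wint_linear] expects. *)
have cvgB : m%:R ^+ 2 * B m - C3S f f' a @[m --> \oo] --> 0.
  have := @cvg_wint R f a a_gt0 f_ge0 f_int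
    (fun m x => m%:R ^+ 2 * szasz_bias F m x ^+ 2 + 0 * szasz_bias F m x ^+ 2)
    (fun x => bS f' x ^+ 2) (M ^+ 2) _ _ _.
  move=> H; have {}H : wint f a (fun x => m%:R ^+ 2 * szasz_bias F m x ^+ 2 +
      0 * szasz_bias F m x ^+ 2) @[m --> \oo] --> C3S f f' a.
    apply: H.
    - by move=> m; apply: measurable_funD; apply: measurable_funM.
    - move=> m x m0 x0; rewrite mul0r addr0 -exprMn normrX -exprMn.
      have M0 : 0 <= M := le_trans (normr_ge0 _) (f'_le 0 (lexx 0)).
      have m1 : 0 < m%:R :> R by rewrite ltr0n.
      rewrite ler_pXn2r// ?nnegrE ?mulr_ge0 ?addr_ge0// normrM ger0_norm//.
      apply: (le_trans (ler_wpM2l (ltW m1) (szasz_bias_le F_derivative f_derivative f'_le F_range m0 x0))).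
      rewrite mulrCA ler_wpM2l// mulrCA divff ?mulr1 ?gt_eqF//.
      by rewrite lerDr.
    - move=> x x0.
      apply: (@cvg_trans _ ((m%:R * szasz_bias F m x) ^+ 2 @[m --> \oo])).
        by apply: near_eq_cvg; apply: nearW => m; ring.
      have H := cvg_szasz_bias F_derivative f_derivative f'_le F_range x0.
      exact: (cvgM H H).
  rewrite -(subrr (C3S f f' a)); apply: cvgB; last exact: cvg_cst.
  move: H; apply: cvg_trans; apply: near_eq_cvg; apply: nearW => m.
  rewrite /= (@wint_linear R f a a_gt0 f_ge0 f_int _ _ _ _ 1 1 (msB2 m) (msB2 m) (bB m) (bB m)).
  by rewrite mul0r addr0.
(* The remainders are exact differences: what carries the factor 1 / n goes into the first, the
   squared bias into the second. *)
exists (fun m n => n%:R^-1 * (V m - C1S F f a + (Num.sqrt m%:R)^-1 * C2S f a)),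
  (fun m n => B m - m%:R ^- 2 * C3S f f' a); split.
- apply: little_o_mn_fst cvgV => m n m0 n0; congr `| _ |.
  have : 0 < Num.sqrt m%:R :> R by rewrite sqrtr_gt0 ltr0n.
  have : n%:R != 0 :> R by rewrite pnatr_eq0 -lt0n.
  move: (Num.sqrt m%:R) n%:R (V m) (C1S F f a) (C2S f a) => s k v c1 c2 k0 s0.
  by field; rewrite k0 gt_eqF.
- apply: little_o_mn_fst cvgB => m n m0 n0; congr `| _ |.
  have : m%:R != 0 :> R by rewrite pnatr_eq0 -lt0n.
  move: (m%:R) (B m) (C3S f f' a) => k b c k0.
  by field.
- move=> m n m0 n0.
  rewrite (szasz_MISE_wint X_iid F_cdf F_continuous f_ge0 f_int a_gt0 m0 n0).
  congr (_%:E); rewrite -/(V m) -/(B m).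
  move: (V m) (B m) (C1S _ _ _) (C2S _ _) (C3S _ _ _) => v b c1 c2 c3.
  ring.
Qed.
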